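(* Consider the DLR Euler--Maruyama scheme with uniform time step $\Delta t=T/N$, $N\in\mathbb N$. Assume: (i) linear growth: $|a(s,x)|^2+\|b(s,x)\|_{\mathrm F}^2\le C_{\mathrm{lgb}}(1+|x|^2)$ for all $s\ge 0$, $x\in\mathbb R^d$, with $C_{\mathrm{lgb}}>0$; (ii) the smallest eigenvalue $\sigma_0$ of $C_{Y_0}=\mathbb E[Y_0Y_0^\top]$ is strictly positive; (iii) there is $\sigma_B>0$ such that $b(t,x)b(t,x)^\top\succeq\sigma_B I_{d\times d}$ for all $t$ and all $x\in\mathbb R^d$; (iv) for every $n=0,\dots,N$, with $\sigma_n^k$ the smallest eigenvalue of $C_{Y_n}=\mathbb E[Y_nY_n^\top]$ and $X_0=U_0^\top Y_0$, $$\Delta t\le \frac{\sqrt{\sigma_n^k}}{\sqrt{C_{\mathrm{lgb}}}\,\sqrt{K_1(T)}},\qquad K_1(T):=5(1+\mathbb E[|X_0|^2])\exp\left(C_{\mathrm{lgb}}(2T^2+8T)\right).$$ Then, for all $n=0,\dots,N-1$, $$C_{Y_{n+1}}\succeq \min\Big\{\sigma_0,\ \frac{\sigma_B^2}{4C_{\mathrm{lgb}}(1+K_1(T))}\Big\}\, I_{k\times k}.$$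
   Context: Setting. $(\Omega,\mathcal F,\mathbb P,(\mathcal F_t)_{t\ge 0})$ is a filtered complete probability space with the usual conditions, $W$ an $m$-dimensional $(\mathcal F_t)$-Brownian motion, $T>0$, $1\le k\le d$. The maps $a:[0,\infty)\times\mathbb R^d\to\mathbb R^d$ and $b:[0,\infty)\times\mathbb R^d\to\mathbb R^{d\times m}$ are Borel measurable. Notation. $|v|$ Euclidean norm, $\|A\|_{\mathrm F}$ Frobenius norm; $A\succeq B$ means $A-B$ is positive semidefinite. For $Y\in L^2(\Omega;\mathbb R^k)$, $C_Y:=\mathbb E[YY^\top]$. For $U\in\mathbb R^{k\times d}$ with orthonormal rows, $P_U:=U^\top U$. DLR Euler--Maruyama scheme. Given a grid $0=t_0<t_1<\dots<t_N=T$, $\Delta t_n=t_{n+1}-t_n$, $\Delta W_n=W(t_{n+1})-W(t_n)$, and initial data $U_0\in\mathbb R^{k\times d}$ with $U_0U_0^\top=I_{k\times k}$ and $Y_0\in L^2(\Omega;\mathbb R^k)$ $\mathcal F_0$-measurable, for $n=0,\dots,N-1$ set $$\tilde Y_{n+1}=Y_n+U_na(t_n,U_n^\top Y_n)\Delta t_n+U_nb(t_n,U_n^\top Y_n)\Delta W_n,$$ let $\tilde U_{n+1}$ solve $$C_{Y_n}\tilde U_{n+1}=C_{Y_n}U_n+\mathbb E[Y_na(t_n,U_n^\top Y_n)^\top](I_{d\times d}-P_{U_n})\Delta t_n$$ (a solution always exists; if $C_{Y_n}$ is singular take the one of minimal norm), compute the reduced QR decomposition $\tilde U_{n+1}^\top=U_{n+1}^\top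 R_{n+1}$, with $U_{n+1}U_{n+1}^\top=I_{k\times k}$ and $R_{n+1}\in\mathbb R^{k\times k}$ upper triangular (QR by Cholesky factorization or Gram--Schmidt, i.e. positive diagonal), and set $Y_{n+1}=R_{n+1}\tilde Y_{n+1}$, so that $U_{n+1}^\top Y_{n+1}=\tilde U_{n+1}^\top\tilde Y_{n+1}$. The approximation is $X_n=U_n^\top Y_n$. *)

(* Defs.v *)
From HB Require Import structures.
From mathcomp Require Import all_boot all_order all_algebra.
From mathcomp Require Import all_classical all_reals all_analysis.

Set Implicit Arguments.
Unset Strict Implicit.
Unset Printing Implicit Defensive.

Import Order.TTheory GRing.Theory Num.Theory.
Import numFieldNormedType.Exports.

Local Open Scope classical_set_scope.
Local Open Scope ring_scope.

Section Matrices.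
Context {R : realType}.

(* The library norm `|A| on matrices is the sup norm. The Frobenius norm of a
   column vector, an element of 'M_(p, 1), is its Euclidean norm. *)
Definition fnorm {p q : nat} (A : 'M[R]_(p, q)) : R :=
  Num.sqrt (\sum_i \sum_j A i j ^+ 2).

Definition psd {n : nat} (A : 'M[R]_n) : Prop :=
  A^T = A /\ forall v : 'cV[R]_n, 0 <= (v^T *m A *m v) 0 0.

Definition loewner_ge {n : nat} (A B : 'M[R]_n) : Prop := psd (A - B).

Definition smallest_eigenvalue {n : nat} (A : 'M[R]_n) (s : R) : Prop :=
  eigenvalue A s /\ forall l, eigenvalue A l -> s <= l.

Definition borelM (p q : nat) :=
  g_sigma_algebraType [set B : set 'M[R]_(p, q) | open B].

(* Coefficients are given on all of R in the time variable, but only their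
   restriction to nonnegative times matters. *)
Definition borel_coefficient {d p q : nat}
    (f : R -> 'cV[R]_d -> 'M[R]_(p, q)) : Prop :=
  measurable_fun [set z : measurableTypeR R * borelM d 1 | 0 <= z.1]
    ((fun z => f z.1 z.2) : measurableTypeR R * borelM d 1 -> borelM p q).

Definition measurable_wrt {Omega : Type} (G : set (set Omega)) {p q : nat}
    (X : Omega -> 'M[R]_(p, q)) : Prop :=
  forall B : set (borelM p q), measurable B -> G (X @^-1` B).

End Matrices.

Section Probability.
Context {R : realType} {dO : measure_display} {Omega : measurableType dO}.
Variable P : probability Omega R.

(* Entrywise expectation; an entry whose expectation is not finite is sent to 0,
   which does not happen for products of square-integrable variables. *)
Definition Emx {p q : nat} (M : Omega -> 'M[R]_(p, q)) : 'M[R]_(p, q) :=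
  \matrix_(i, j) fine 'E_P[fun w => M w i j].

Definition second_moment {k : nat} (Y : Omega -> 'cV[R]_k) : 'M[R]_k :=
  Emx (fun w => Y w *m (Y w)^T).

Definition square_integrable {k : nat} (Y : Omega -> 'cV[R]_k) : Prop :=
  measurable_wrt measurable Y /\ ('E_P[fun w => (fnorm (Y w) ^+ 2)%R] < +oo)%E.

Record usual_filtration (F : R -> set (set Omega)) : Prop := UsualFiltration {
  uf_complete : measure_is_complete P ;
  uf_sigma_algebra : forall t : R, 0 <= t -> sigma_algebra setT (F t) ;
  uf_sub : forall t : R, 0 <= t -> F t `<=` measurable ;
  uf_monotone : forall s t : R, 0 <= s -> s <= t -> F s `<=` F t ;
  uf_right_continuous : forall t : R, 0 <= t ->
    F t = \bigcap_(s in [set s | t < s]) F s ;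
  uf_null : forall A, P.-negligible A -> F 0 A }.

Record brownian_motion (F : R -> set (set Omega)) {m : nat}
    (W : R -> Omega -> 'cV[R]_m) : Prop := BrownianMotion {
  bm_start : {ae P, forall w, W 0 w = 0} ;
  bm_adapted : forall t : R, 0 <= t -> measurable_wrt (F t) (W t) ;
  bm_independent : forall s t : R, 0 <= s -> s < t ->
    forall (A : set Omega) (B : set (borelM m 1)), F s A -> measurable B ->
    (P (A `&` [set w | B (W t w - W s w)%R]) =
     P A * P [set w | B (W t w - W s w)%R])%E ;
  (* The increment has law N(0, (t - s) I_m): its coordinates are independent
     with law N(0, t - s). The last argument of normal_prob is the standard
     deviation, not the variance. *)
  bm_gaussian : forall s t : R, 0 <= s -> s < t ->
    forall B : 'I_m -> set R, (forall i, measurable (B i)) ->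
    (P [set w | forall i, B i (W t w i 0 - W s w i 0)%R] =
     \prod_(i < m) normal_prob 0%R (Num.sqrt (t - s)%R) (B i))%E ;
  bm_continuous :
    {ae P, forall w, {within `[0, +oo[, continuous (fun t => W t w)}} }.

Record dlr_euler_maruyama (F : R -> set (set Omega)) {k d m : nat}
    (W : R -> Omega -> 'cV[R]_m)
    (a : R -> 'cV[R]_d -> 'cV[R]_d) (b : R -> 'cV[R]_d -> 'M[R]_(d, m))
    (N : nat) (t : nat -> R)
    (U : nat -> 'M[R]_(k, d)) (Y : nat -> Omega -> 'cV[R]_k)
    (Ut : nat -> 'M[R]_(k, d)) (Yt : nat -> Omega -> 'cV[R]_k)
    (Rq : nat -> 'M[R]_k) : Prop := DLREulerMaruyama {
  dlr_U0 : U 0%N *m (U 0%N)^T = 1%:M ;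
  dlr_Y0_L2 : square_integrable (Y 0%N) ;
  dlr_Y0_meas : measurable_wrt (F 0) (Y 0%N) ;
  dlr_Yt : forall n, (n < N)%N -> forall w,
    let X := (U n)^T *m Y n w in
    Yt n.+1 w = Y n w + (t n.+1 - t n) *: (U n *m a (t n) X)
                + U n *m b (t n) X *m (W (t n.+1) w - W (t n) w) ;
  dlr_Ut : forall n, (n < N)%N ->
    let C := second_moment (Y n) in
    let rhs := C *m U n +
      (t n.+1 - t n) *:
        (Emx (fun w => Y n w *m (a (t n) ((U n)^T *m Y n w))^T)
           *m (1%:M - (U n)^T *m U n)) in
    C *m Ut n.+1 = rhs /\
    (C \notin unitmx ->
       forall V : 'M[R]_(k, d), C *m V = rhs -> fnorm (Ut n.+1) <= fnorm V) ;
  dlr_QR : forall n, (n < N)%N ->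
    [/\ (Ut n.+1)^T = (U n.+1)^T *m Rq n.+1,
        U n.+1 *m (U n.+1)^T = 1%:M,
        (forall i j : 'I_k, (j < i)%N -> Rq n.+1 i j = 0) &
        forall i : 'I_k, 0 < Rq n.+1 i i] ;
  dlr_Y : forall n, (n < N)%N -> forall w,
    Y n.+1 w = Rq n.+1 *m Yt n.+1 w }.

End Probability.

Definition K1 {R : realType} (Clgb T EX0 : R) : R :=
  5 * (1 + EX0) * expR (Clgb * (2 * T ^+ 2 + 8 * T)).

(* Main.v *)
(* Write [V] for the increment [Ut_{n+1} - U_n] of the basis. As [C_{Y_n}] is
   invertible, [V *m U_n^T = 0], so [Rq^T *m Rq = Ut *m Ut^T = 1 + V *m V^T] and
   [Rq^T] does not decrease norms: it suffices to bound the second moment of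
   [Yt_{n+1}] from below. Conditioning on [F_{t_n}] leaves only the diagonal
   noise terms, and for a unit vector [v], with [x = E (v . Y_n)^2] and
   [q = sigmaB / (2 sqrt (C K))],
     E (v . Yt)^2 >= (sqrt x - dt sqrt (C K))^2 + dt sigmaB >= min (x, q^2),
   where the step restriction enters through [dt sqrt (C K) <= sqrt x]. This
   needs the moment bound [1 + E |X_n|^2 <= K]. It follows from a one-step
   growth factor: [V^T Y_n] is [dt] times an L^2-projection of the part of the
   drift orthogonal to [U_n], and the step restriction forces [|V| <= 1]. *)
Require Import Defs.
From HB Require Import structures.
From mathcomp Require Import all_boot all_order all_algebra.
From mathcomp Require Import all_classical all_reals all_analysis.
From mathcomp Require Import measurable_realfun ring lra.

Set Implicit Arguments.
Unset Strict Implicit.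
Unset Printing Implicit Defensive.

Import Order.TTheory GRing.Theory Num.Theory.
Import numFieldNormedType.Exports.

Local Open Scope classical_set_scope.
Local Open Scope ring_scope.

(** * Square-integrable random variables and their inner product *)

Section SquareIntegrable.
Context {R : realType} {dO : measure_display} {Omega : measurableType dO}.
Variable P : probability Omega R.
Implicit Types f g : Omega -> R.

(** Moment bound and lower bound can share one induction because the step restriction is assumed at
    every time: it makes [C_{Y_n}] invertible and controls [V] by itself, so the lower bound under
    proof is never fed back into the estimate of the basis. That lower bound is one constant [M] for
    all steps: it does not deteriorate, since a step preserves every constant that lies below both
    of the quantities compared. The delicate point is the exponent of [K1]. The cross term between
    state and drift contributes [2 * dt * sqrt C] per step, hence [2 * T * sqrt C] in total, which
    is not of the form [C * (2 * T ^+ 2 + 8 * T)]. This excess, like the one coming from the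
    second-order terms, is reduced to an additive constant, [5 / 4] altogether, and the factor 5 of
    [K1] pays for [expR (5 / 4)]. Conditioning is expressed by testing the noise against functions
    measurable at the current time, so only ordinary integrals occur. *)

Definition sqint f :=
  measurable_fun setT f /\ P.-integrable setT (EFin \o (fun w => f w ^+ 2)).

Definition l2dot f g : R := \int[P]_w (f w * g w).

Lemma sqint_dominated f g : measurable_fun setT f ->
  P.-integrable setT (EFin \o g) -> (forall w, f w ^+ 2 <= g w) -> sqint f.
Proof.
move=> mf ig fg; split => //.
apply: (le_integrable measurableT _ _ ig).
  by apply/measurable_EFinP; exact: measurable_funX.
move=> w _; rewrite /= lee_fin ger0_norm ?sqr_ge0//.
by rewrite (le_trans (fg w))// ler_norm.
Qed.

Lemma sqint_mul f g : sqint f -> sqint g ->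
  P.-integrable setT (EFin \o (fun w => f w * g w)).
Proof.
move=> [mf if2] [mg ig2].
apply: (@le_integrable _ _ _ _ _ measurableT _
  (fun w => (f w ^+ 2)%:E + (g w ^+ 2)%:E)%E).
- by apply/measurable_EFinP; exact: measurable_funM.
- move=> w _; rewrite /= lee_fin normrM [leRHS]ger0_norm ?addr_ge0 ?sqr_ge0//.
  rewrite -(real_normK (num_real (f w))) -(real_normK (num_real (g w))).
  by have := sqr_ge0 (`|f w| - `|g w|); have := normr_ge0 (f w);
    have := normr_ge0 (g w); nra.
- exact: integrableD.
Qed.

Lemma sqint_cst c : sqint (fun=> c).
Proof. by split=> //; exact: finite_measure_integrable_cst. Qed.

Lemma sqintD f g : sqint f -> sqint g -> sqint (fun w => f w + g w).
Proof.
move=> [mf if2] [mg ig2].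
apply: (@sqint_dominated _ (fun w => 2 * f w ^+ 2 + 2 * g w ^+ 2)).
- exact: measurable_funD.
- apply: (@integrableD _ _ _ _ _ measurableT (fun w => (2 * f w ^+ 2)%:E)
    (fun w => (2 * g w ^+ 2)%:E)) => //.
    by apply: (integrableZl measurableT 2 if2).
  by apply: (integrableZl measurableT 2 ig2).
- by move=> w; have := sqr_ge0 (f w - g w); nra.
Qed.

Lemma sqintZ c f : sqint f -> sqint (fun w => c * f w).
Proof.
move=> [mf if2]; apply: (@sqint_dominated _ (fun w => c ^+ 2 * f w ^+ 2)).
- exact: measurable_funM.
- by apply: (integrableZl measurableT (c ^+ 2) if2).
- by move=> w; rewrite exprMn.
Qed.

Lemma sqint_sum I (s : seq I) (h : I -> Omega -> R) :
  (forall i, sqint (h i)) -> sqint (fun w => \sum_(i <- s) h i w).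
Proof.
move=> sh; elim: s => [|i s ih].
  by under [X in sqint X]eq_fun do rewrite big_nil; exact: sqint_cst.
by under [X in sqint X]eq_fun do rewrite big_cons; exact: sqintD.
Qed.

Lemma eq_l2dot f f' g g' : f =1 f' -> g =1 g' -> l2dot f g = l2dot f' g'.
Proof. by move=> /funext-> /funext->. Qed.

Lemma l2dotC f g : l2dot f g = l2dot g f.
Proof. by apply: eq_Rintegral => w _; rewrite mulrC. Qed.

Lemma l2dot_ge0 f : 0 <= l2dot f f.
Proof. by apply: Rintegral_ge0 => w _; rewrite -expr2 sqr_ge0. Qed.

Lemma l2dotDl f g h : sqint f -> sqint g -> sqint h ->
  l2dot (fun w => f w + g w) h = l2dot f h + l2dot g h.
Proof.
move=> sf sg sh; rewrite /l2dot -RintegralD//; [|exact: sqint_mul..].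
by apply: eq_Rintegral => w _; rewrite mulrDl.
Qed.

Lemma l2dotDr f g h : sqint f -> sqint g -> sqint h ->
  l2dot h (fun w => f w + g w) = l2dot h f + l2dot h g.
Proof. by move=> *; rewrite l2dotC l2dotDl// (l2dotC f) (l2dotC g). Qed.

Lemma l2dotZl c f h : sqint f -> sqint h ->
  l2dot (fun w => c * f w) h = c * l2dot f h.
Proof.
move=> sf sh; rewrite /l2dot -RintegralZl//; last exact: sqint_mul.
by apply: eq_Rintegral => w _; rewrite mulrA.
Qed.

Lemma l2dotZr c f h : sqint f -> sqint h ->
  l2dot h (fun w => c * f w) = c * l2dot h f.
Proof. by move=> *; rewrite l2dotC l2dotZl// l2dotC. Qed.

Lemma l2dot_suml I (s : seq I) (h : I -> Omega -> R) g :
  (forall i, sqint (h i)) -> sqint g ->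
  l2dot (fun w => \sum_(i <- s) h i w) g = \sum_(i <- s) l2dot (h i) g.
Proof.
move=> sh sg; elim: s => [|i s ih].
  rewrite big_nil /l2dot; under eq_Rintegral do rewrite big_nil mul0r.
  by rewrite Rintegral_cst// mul0r.
rewrite big_cons -ih -l2dotDl//; last exact: sqint_sum.
by apply: eq_l2dot => // w; rewrite big_cons.
Qed.

Lemma l2dot_sumr I (s : seq I) (h : I -> Omega -> R) g :
  (forall i, sqint (h i)) -> sqint g ->
  l2dot g (fun w => \sum_(i <- s) h i w) = \sum_(i <- s) l2dot g (h i).
Proof.
by move=> *; rewrite l2dotC l2dot_suml//; apply: eq_bigr => i _; rewrite l2dotC.
Qed.

Lemma l2dot_sqrD f g : sqint f -> sqint g ->
  l2dot (fun w => f w + g w) (fun w => f w + g w) =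
  l2dot f f + 2 * l2dot f g + l2dot g g.
Proof.
move=> sf sg; have sfg := sqintD sf sg.
by rewrite l2dotDl// !l2dotDr// (l2dotC g f); ring.
Qed.

Lemma l2dot_sqrDZ c f g : sqint f -> sqint g ->
  l2dot (fun w => f w + c * g w) (fun w => f w + c * g w) =
  l2dot f f + 2 * c * l2dot f g + c ^+ 2 * l2dot g g.
Proof.
move=> sf sg; rewrite l2dot_sqrD//; last exact: sqintZ.
rewrite l2dotZr// l2dotZl//; last exact: sqintZ.
rewrite l2dotZr//.
by move: (l2dot f f) (l2dot f g) (l2dot g g) => x y z; ring.
Qed.

Lemma l2dot_young c f g : sqint f -> sqint g ->
  2 * c * l2dot f g <= l2dot f f + c ^+ 2 * l2dot g g.
Proof.
move=> sf sg; have := l2dot_ge0 (fun w => f w + - c * g w).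
rewrite l2dot_sqrDZ//.
by move: (l2dot f f) (l2dot f g) (l2dot g g) => x y z; rewrite sqrrN; lra.
Qed.

(** The crude factor 2 is affordable when [f] is itself of order [c]; this serves for [V^T] applied
    to the drift, where [V^T *m Y] is of order [h] in L^2. *)
Lemma l2dot_sqrDZ_le2 c f g : sqint f -> sqint g ->
  l2dot (fun w => f w + c * g w) (fun w => f w + c * g w) <=
  2 * l2dot f f + 2 * c ^+ 2 * l2dot g g.
Proof.
move=> sf sg; rewrite l2dot_sqrDZ//; move: (l2dot_young c sf sg).
by move: (l2dot f f) (l2dot f g) (l2dot g g) => x y z; lra.
Qed.

(** Young's inequality with a free weight [r], applied to the cross term only: the coefficient of
    [l2dot f f] stays 1 plus order [c], as iterating the step requires. *)
Lemma l2dot_sqrDZ_weighted c r f g : 0 < c -> 0 < r -> sqint f -> sqint g ->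
  l2dot (fun w => f w + c * g w) (fun w => f w + c * g w) <=
  l2dot f f + c * (r * l2dot f f + r^-1 * l2dot g g) + c ^+ 2 * l2dot g g.
Proof.
move=> c0 r0 sf sg; rewrite l2dot_sqrDZ//; move: (l2dot_young r^-1 sf sg).
move: (l2dot f f) (l2dot f g) (l2dot g g) => x y z.
rewrite -(ler_pM2l (mulr_gt0 c0 r0)) => yg.
have E1 : c * r * (2 * r^-1 * y) = 2 * c * y by field; rewrite gt_eqF.
have E2 : c * r * (x + r^-1 ^+ 2 * z) = c * (r * x + r^-1 * z).
  by field; rewrite gt_eqF.
by rewrite E1 E2 in yg; rewrite lerD2r lerD2l.
Qed.

Lemma l2dot_cauchy_schwarz f g : sqint f -> sqint g ->
  l2dot f g ^+ 2 <= l2dot f f * l2dot g g.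
Proof.
move=> sf sg; have h c := l2dot_young c sf sg.
have fg := l2dot_ge0 f; have gg := l2dot_ge0 g.
have [g0|g0] := eqVneq (l2dot g g) 0.
  have [->|n0] := eqVneq (l2dot f g) 0; first by rewrite g0 expr2 !mulr0.
  (* If [l2dot g g = 0], this constant makes the left side of Young's inequality [l2dot f f + 1] and
     the right side [l2dot f f]. *)
  have := h ((l2dot f f + 1) / (2 * l2dot f g)); rewrite g0 mulr0 addr0.
  have -> : 2 * ((l2dot f f + 1) / (2 * l2dot f g)) * l2dot f g =
     l2dot f f + 1 by field.
  lra.
have gp : 0 < l2dot g g by rewrite lt_def g0.
have := h (l2dot f g / l2dot g g).
have -> : 2 * (l2dot f g / l2dot g g) * l2dot f g =
  2 * (l2dot f g ^+ 2 / l2dot g g) by field.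
have -> : (l2dot f g / l2dot g g) ^+ 2 * l2dot g g = l2dot f g ^+ 2 / l2dot g g.
  by field.
move=> hh; rewrite -ler_pdivrMr//; lra.
Qed.

End SquareIntegrable.

(** * Independence and noise with prescribed conditional moments *)

Section Independence.
Context {R : realType} {dO : measure_display} {Omega : measurableType dO}.
Variable P : probability Omega R.

(* The joint law of two independent variables is the product of their laws, so
   Fubini's theorem factors the expectation of their product. *)
Lemma independent_mul (h Z : Omega -> R) :
  P.-integrable setT (EFin \o h) -> P.-integrable setT (EFin \o Z) ->
  (forall A B : set R, measurable A -> measurable B ->
    P (h @^-1` A `&` Z @^-1` B) = (P (h @^-1` A) * P (Z @^-1` B))%E) ->
  P.-integrable setT (EFin \o (fun w => h w * Z w)) /\
  \int[P]_w (h w * Z w) = (\int[P]_w h w) * (\int[P]_w Z w).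
Proof.
move=> ih iZ indep.
have mh : measurable_fun setT h by apply/measurable_EFinP; case/integrableP: ih.
have mZ : measurable_fun setT Z by apply/measurable_EFinP; case/integrableP: iZ.
have mhZ : measurable_fun setT (fun w => (h w, Z w)).
  exact: measurable_fun_pair.
pose hM : {mfun Omega >-> R} := mfun_Sub (mem_set mh).
pose ZM : {mfun Omega >-> R} := mfun_Sub (mem_set mZ).
pose hZM : {mfun Omega >-> (R * R)%type} := mfun_Sub (mem_set mhZ).
have lawE : forall X : set (R * R), measurable X ->
    (distribution P hM \x distribution P ZM)%E X = distribution P hZM X.
  by apply: product_measure_unique => A B mA mB; exact: indep.
have mabs : measurable_fun setT (fun z : R * R => (`|z.1 * z.2|)%:E).
  apply/measurable_EFinP; apply: measurableT_comp => //.
  by apply: measurable_funM; [exact: measurable_fst|exact: measurable_snd].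
have mprod : measurable_fun setT (fun z : R * R => (z.1 * z.2)%:E).
  apply/measurable_EFinP.
  by apply: measurable_funM; [exact: measurable_fst|exact: measurable_snd].
have mn (a : R) : measurable_fun setT (fun y : R => (`|a * y|)%:E).
  by apply/measurable_EFinP; apply: measurableT_comp => //; exact: measurable_funM.
have mid : measurable_fun setT (fun y : R => (`|y|)%:E).
  apply/measurable_EFinP; apply: measurableT_comp => //; exact: normr_measurable.
(* Tonelli comes before Fubini: integrability of the product is part of the claim, and holds because
   the integral of [|z.1 * z.2|] under the product law splits into two finite factors. *)
have fin_int : (\int[P]_w (`|h w * Z w|)%:E < +oo)%E.
  have -> : (\int[P]_w (`|h w * Z w|)%:E =
      \int[distribution P hM \x distribution P ZM]_z (`|z.1 * z.2|)%:E)%E.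
    rewrite (eq_measure_integral (distribution P hZM)); last first.
      by move=> A mA _; exact: lawE.
    by rewrite ge0_integral_distribution//= => y; rewrite lee_fin.
  rewrite fubini_tonelli1//.
  rewrite /fubini_F/=.
  under eq_integral => x _.
    under eq_integral => y _ do rewrite normrM EFinM.
    rewrite ge0_integralZl//.
    rewrite ge0_integral_distribution////.
    over.
  have Zfin : (\int[P]_x `|(EFin \o Z) x| < +oo)%E by case/integrableP: iZ.
  have hfin : (\int[P]_x `|(EFin \o h) x| < +oo)%E by case/integrableP: ih.
  rewrite ge0_integralZr//; first last.
    by apply: integral_ge0 => y _; rewrite lee_fin.
  rewrite ge0_integral_distribution////.
  have int0 (f : Omega -> R) : (0 <= \int[P]_x (`|f x|)%:E)%E.
    by apply: integral_ge0 => x _; rewrite lee_fin.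
  by apply: lte_mul_pinfty => //; [exact: int0|rewrite ge0_fin_numE//; exact: int0].
have ihZ : P.-integrable setT (EFin \o (fun w => h w * Z w)).
  apply/integrableP; split; last exact: fin_int.
  by apply/measurable_EFinP; exact: measurable_funM.
split => //.
have iprod : (distribution P hM \x distribution P ZM)%E.-integrable setT
    (fun z : R * R => (z.1 * z.2)%:E).
  apply/integrableP; split => //.
  rewrite (eq_measure_integral (distribution P hZM)); last first.
    by move=> A mA _; exact: lawE.
  by rewrite ge0_integral_distribution//; exact: measurableT_comp.
have E1 : (\int[P]_w (h w * Z w)%:E =
    \int[distribution P hM \x distribution P ZM]_z (z.1 * z.2)%:E)%E.
  rewrite (eq_measure_integral (distribution P hZM)); last first.
    by move=> A mA _; exact: lawE.
  by rewrite integral_distribution.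
have iZd : (distribution P ZM).-integrable setT (EFin : R -> \bar R).
  apply/integrableP; split; first exact/measurable_EFinP.
  rewrite ge0_integral_distribution//.
  by case/integrableP: iZ.
have ihd : (distribution P hM).-integrable setT (EFin : R -> \bar R).
  apply/integrableP; split; first exact/measurable_EFinP.
  rewrite ge0_integral_distribution//.
  by case/integrableP: ih.
have hE : (\int[distribution P hM]_x x%:E = \int[P]_w (h w)%:E)%E.
  by rewrite integral_distribution//; exact/measurable_EFinP.
have ZE : (\int[distribution P ZM]_x x%:E = \int[P]_w (Z w)%:E)%E.
  by rewrite integral_distribution//; exact/measurable_EFinP.
rewrite /Rintegral E1 -integral12_prod_meas1// /fubini_F/=.
under eq_integral => x _.
  under eq_integral => y _ do rewrite EFinM.
  rewrite integralZl// ZE.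
  over.
have fZ : (\int[P]_w (Z w)%:E)%E \is a fin_num by exact: integrable_fin_num.
have fh : (\int[P]_w (h w)%:E)%E \is a fin_num by exact: integrable_fin_num.
rewrite -[in LHS](fineK fZ) integralZr// hE.
by rewrite -(fineK fh) -EFinM.
Qed.

(** Conditional mean 0 and conditional covariance [v] times the identity given [G], expressed
    through integrable test functions in [G]. The integrability in the last clause, at the test
    function [g ^+ 2], makes [g * xi j] square-integrable when [g] is. *)
Definition white_noise (G : (Omega -> R) -> Prop) (v : R) m
    (xi : 'I_m -> Omega -> R) :=
  [/\ forall j, sqint P (xi j),
      forall h, G h -> P.-integrable setT (EFin \o h) -> forall j,
        \int[P]_w (h w * xi j w) = 0 &
      forall h, G h -> P.-integrable setT (EFin \o h) -> forall i j,
        P.-integrable setT (EFin \o (fun w => h w * (xi i w * xi j w))) /\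
        \int[P]_w (h w * (xi i w * xi j w)) =
          (i == j)%:R * v * \int[P]_w h w].

Lemma noise_sqint (G : (Omega -> R) -> Prop) v m (xi : 'I_m -> Omega -> R) g :
  (forall f g, G f -> G g -> G (fun w => f w * g w)) ->
  white_noise G v xi -> G g -> sqint P g ->
  forall j, sqint P (fun w => g w * xi j w).
Proof.
move=> GM [sxi _ noise2] Gg sg j.
have gg : (fun w => g w ^+ 2) = fun w => g w * g w by apply/funext => w.
have [] := noise2 (fun w => g w ^+ 2) _ _ j j.
- by rewrite gg; exact: GM.
- by case: sg.
- move=> ih _; split.
    by apply: measurable_funM; [case: sg|case: (sxi j)].
  apply: eq_integrable ih => // w _ /=.
  by congr EFin; ring.
Qed.

(** A one-step Ito isometry: the test functions [f * g j] remove the drift-noise terms, and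
    [g i * g j] the off-diagonal noise terms. *)
Lemma noise_l2dot (G : (Omega -> R) -> Prop) v m (xi : 'I_m -> Omega -> R)
    (f : Omega -> R) (g : 'I_m -> Omega -> R) :
  (forall f g, G f -> G g -> G (fun w => f w * g w)) ->
  white_noise G v xi ->
  G f -> sqint P f -> (forall j, G (g j)) -> (forall j, sqint P (g j)) ->
  let F w := f w + \sum_j g j w * xi j w in
  sqint P F /\ l2dot P F F = l2dot P f f + v * \sum_j l2dot P (g j) (g j).
Proof.
move=> GM noise Gf sf Gg sg F.
have sgxi j : sqint P (fun w => g j w * xi j w) by exact: (noise_sqint GM noise).
have ssum : sqint P (fun w => \sum_j g j w * xi j w) by exact: sqint_sum.
split; first exact: sqintD.
have [sxi noise1 noise2] := noise.
rewrite l2dot_sqrD//.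
rewrite l2dot_sumr// big1 ?mulr0 ?addr0; last first.
  move=> j _; rewrite -[RHS](noise1 (fun w => f w * g j w) _ _ j).
  - by apply: eq_Rintegral => w _; rewrite mulrA.
  - exact: GM.
  - exact: sqint_mul.
congr (_ + _); rewrite l2dot_suml// mulr_sumr; apply: eq_bigr => i _.
rewrite l2dot_sumr// (bigD1 i)//= big1 ?addr0; last first.
  move=> j ji.
  have [|_] := noise2 (fun w => g i w * g j w) (GM _ _ (Gg i) (Gg j)) _ i j.
    exact: sqint_mul.
  rewrite eq_sym (negbTE ji) !mul0r => <-.
  by apply: eq_Rintegral => w _; ring.
have [|_] := noise2 (fun w => g i w * g i w) (GM _ _ (Gg i) (Gg i)) _ i i.
  exact: sqint_mul.
rewrite eqxx mul1r => <-.
by apply: eq_Rintegral => w _; ring.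
Qed.

End Independence.

(** * First and second moments of a centred normal law *)

Section NormalMoments.
Context {R : realType}.
Variable s : R.
Hypothesis s_gt0 : 0 < s.
Local Notation mu := (@lebesgue_measure R).
Local Notation p := (normal_pdf 0 s).

(** Change of variables is phrased with a Radon-Nikodym derivative, which agrees almost everywhere
    with the explicit density because both integrate to the same measure on every measurable set. *)
Lemma ge0_integral_normal_prob (f : R -> \bar R) :
  measurable_fun setT f -> (forall x, (0 <= f x)%E) ->
  (\int[normal_prob 0 s]_x f x = \int[mu]_x (f x * (p x)%:E))%E.
Proof.
move=> mf f0.
have dom := normal_prob_dominates 0 s.
rewrite -(Radon_Nikodym_SigmaFinite.change_of_variables dom)//.
have mRN : measurable_fun setT
    (Radon_Nikodym_SigmaFinite.f (normal_prob 0 s) mu).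
  by apply: (measurable_int mu); exact: Radon_Nikodym_SigmaFinite.f_integrable.
have mp : measurable_fun setT (fun x => (p x)%:E).
  by apply/measurable_EFinP; exact: measurable_normal_pdf.
apply: ae_eq_integral => //; [exact: emeasurable_funM..|].
apply: ae_eqe_mul2l; apply: integral_ae_eq => //.
  exact: Radon_Nikodym_SigmaFinite.f_integrable.
by move=> E _ mE; rewrite -Radon_Nikodym_SigmaFinite.f_integral.
Qed.

Let sn0 : s != 0. Proof. by rewrite gt_eqF. Qed.

Lemma normal_pdf0E x : p x = normal_peak s * expR (- (x ^+ 2 / (s ^+ 2 *+ 2))).
Proof. by rewrite normal_pdfE// /normal_fun subr0 mulNr. Qed.

Lemma is_derive_normal_pdf (x : R) : is_derive x 1 p (- (x / s ^+ 2) * p x).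
Proof.
have -> : p = fun x => normal_peak s * expR (- (x ^+ 2 / (s ^+ 2 *+ 2))).
  by apply/funext => y; exact: normal_pdf0E.
apply: is_derive_eq.
rewrite !scaler1 /GRing.scale/= -mulrnAr -mulr_natr.
by field.
Qed.

(** [expR y >= 1 + y] at [y = x ^+ 2 / (2 * s ^+ 2)] bounds [x * p x] by a constant multiple of
    [x^-1]. *)
Lemma cvg_id_mul_normal_pdf : x * p x @[x --> +oo] --> 0.
Proof.
apply: (@squeeze_cvgr _ _ _ _ (cst 0) (fun x => normal_peak s * (s ^+ 2 *+ 2) * x^-1)).
- near=> x.
  have x0 : 0 < x by near: x; exact: nbhs_pinfty_gt.
  have k0 : 0 < s ^+ 2 *+ 2 by rewrite pmulrn_lgt0// exprn_gt0.
  rewrite mulr_ge0 ?normal_pdf_ge0 ?(ltW x0)//= normal_pdf0E mulrCA -mulrA.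
  rewrite ler_wpM2l ?normal_peak_ge0// expRN.
  have e0 := expR_gt0 (x ^+ 2 / (s ^+ 2 *+ 2)).
  rewrite ler_pdivrMr// mulrAC ler_pdivlMr// -expr2 mulrC -ler_pdivrMr//.
  by have := expR_ge1Dx (x ^+ 2 / (s ^+ 2 *+ 2)); lra.
- exact: cvg_cst.
- rewrite -(mulr0 (normal_peak s * (s ^+ 2 *+ 2))).
  by apply: cvgMr; apply/(gtr0_cvgV0 (f := id)) => //; exact: nbhs_pinfty_gt.
Unshelve. all: by end_near. Qed.

(* Both [expR (- x)] and [(x ^+ 2 - s ^+ 2) * p x + M * expR (- x)] have
   elementary antiderivatives and are nonnegative on the half-line, for
   [M = s ^+ 2 * normal_peak s * expR s]. *)
Lemma half_second_moment_normal :
  (\int[mu]_(x in `[0%R, +oo[) (x ^+ 2 * p x)%:E =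
   (s ^+ 2)%:E * \int[mu]_(x in `[0%R, +oo[) (p x)%:E)%E.
Proof.
pose M := s ^+ 2 * normal_peak s * expR s.
have M0 : 0 <= M.
  apply: mulr_ge0; last exact: expR_ge0.
  by apply: mulr_ge0; [exact: sqr_ge0|exact: normal_peak_ge0].
pose f x := x ^+ 2 * p x - s ^+ 2 * p x + M * expR (- x).
have cp : continuous p by exact: continuous_normal_pdf.
have ce : continuous (fun x : R => M * expR (- x)).
  move=> x; apply: cvgMr.
  by apply: (cvg_comp _ expR); [exact: opp_continuous|exact: continuous_expR].
have cxp : continuous (fun x : R => x ^+ 2 * p x).
  by move=> x; apply: cvgM; [exact: sqr_continuous|exact: cp].
have csp : continuous (fun x : R => s ^+ 2 * p x).
  by move=> x; apply: cvgMr; exact: cp.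
have cf : continuous f.
  by move=> x; apply: cvgD; [apply: cvgB; [exact: cxp|exact: csp]|exact: ce].
have f0 x : 0 <= x -> 0 <= f x.
  move=> x0; rewrite /f.
  have p0 := normal_pdf_ge0 0 s x.
  have [sx|xs] := leP s x.
    rewrite -mulrBl; apply: addr_ge0; apply: mulr_ge0 => //.
    by rewrite subr_ge0 lerXn2r// nnegrE ltW.
  have pp : p x <= normal_peak s by exact: normal_pdf_ub.
  have e1 : 1 <= expR s * expR (- x).
    by rewrite -expRD -[leLHS]expR0 ler_expR subr_ge0 ltW.
  have : s ^+ 2 * p x <= M * expR (- x).
    have -> : M * expR (- x) = s ^+ 2 * (normal_peak s * (expR s * expR (- x))).
      by rewrite /M; ring.
    apply: (ler_wpM2l (sqr_ge0 s)); apply: (le_trans pp).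
    by rewrite ler_peMr ?normal_peak_ge0.
  by have := mulr_ge0 (sqr_ge0 x) p0; lra.
have intf : (\int[mu]_(x in `[0%R, +oo[) (f x)%:E = M%:E)%E.
  (* As [p' = - (x / s ^+ 2) * p], the first term has derivative [(x ^+ 2 - s ^+ 2) * p]. [F] runs
     from [- M] at 0 to 0 at infinity. *)
  pose F x := - (s ^+ 2 * (x * p x)) - M * expR (- x).
  have dF (x : R) : is_derive x 1 F (f x).
    have := is_derive_normal_pdf x => dp.
    apply: is_derive_eq.
    rewrite /f !scaler1 /GRing.scale/=.
    by field.
  rewrite (@ge0_continuous_FTC2y _ f F 0 0)//.
  - by rewrite /F mul0r mulr0 oppr0 expR0 mulr1 -EFinB !sub0r opprK.
  - exact: continuous_subspaceT.
  - rewrite -[0]subr0 -[X in X - _]oppr0 -[X in - X - _](mulr0 (s ^+ 2)).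
    rewrite -[X in _ - X](mulr0 M).
    apply: cvgB; last by apply: cvgMr; exact: cvgr_expR.
    by apply: cvgN; apply: cvgMr; exact: cvg_id_mul_normal_pdf.
  - apply: cvg_at_right_filter.
    by apply: differentiable_continuous; apply/derivable1_diffP.
  - by move=> x _; rewrite derive1E; exact: derive_val.
have intE : (\int[mu]_(x in `[0%R, +oo[) (M * expR (- x))%:E = M%:E)%E.
  pose F x := - (M * expR (- x)).
  have dF (x : R) : is_derive x 1 F (M * expR (- x)).
    apply: is_derive_eq.
    by rewrite /GRing.scale/=; ring.
  rewrite (@ge0_continuous_FTC2y _ (fun x => M * expR (- x)) F 0 0)//.
  - by rewrite /F oppr0 expR0 mulr1 -EFinB sub0r opprK.
  - by move=> x _; rewrite mulr_ge0// expR_ge0.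
  - exact: continuous_subspaceT.
  - rewrite -[0]oppr0 -[X in - X](mulr0 M).
    by apply: cvgN; apply: cvgMr; exact: cvgr_expR.
  - apply: cvg_at_right_filter.
    by apply: differentiable_continuous; apply/derivable1_diffP.
  - by move=> x _; rewrite derive1E; exact: derive_val.
have m0 : measurable (`[0%R, +oo[ : set R) by [].
have mc (h : R -> R) : continuous h -> measurable_fun (`[0%R, +oo[ : set R) (EFin \o h).
  move=> ch; apply/measurable_EFinP/measurable_funTS.
  exact: continuous_measurable_fun.
have x0P (x : R) : (`[0%R, +oo[%classic : set R) x -> 0 <= x by rewrite /= in_itv/= andbT.
have xx0 (x : R) : 0 <= x ^+ 2 * p x.
  by rewrite mulr_ge0 ?sqr_ge0 ?normal_pdf_ge0.
have sx0 (x : R) : 0 <= s ^+ 2 * p x.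
  by rewrite mulr_ge0 ?sqr_ge0 ?normal_pdf_ge0.
have ee0 (x : R) : 0 <= M * expR (- x) by rewrite mulr_ge0 ?expR_ge0.
(* The identity [x ^+ 2 * p + M * expR (- x) = f + s ^+ 2 * p] has only nonnegative terms, so it
   integrates termwise in the extended reals; the finite [M] is cancelled afterwards. *)
have sumE : (\int[mu]_(x in `[0%R, +oo[) (x ^+ 2 * p x)%:E + M%:E =
             M%:E + \int[mu]_(x in `[0%R, +oo[) (s ^+ 2 * p x)%:E)%E.
  rewrite -[in LHS]intE -[in RHS]intf.
  rewrite -ge0_integralD//; try exact: mc; last 2 first.
    by move=> x _; rewrite lee_fin.
    by move=> x _; rewrite lee_fin.
  rewrite -ge0_integralD//; try exact: mc; last 2 first.
    by move=> x /x0P x0; rewrite lee_fin f0.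
    by move=> x _; rewrite lee_fin.
  by apply: eq_integral => x _; rewrite -!EFinD /f; congr EFin; ring.
have -> : ((s ^+ 2)%:E * \int[mu]_(x in `[0%R, +oo[) (p x)%:E =
    \int[mu]_(x in `[0%R, +oo[) (s ^+ 2 * p x)%:E)%E.
  rewrite -ge0_integralZl//; first exact: mc.
    by move=> x _; rewrite lee_fin normal_pdf_ge0.
  by rewrite lee_fin sqr_ge0.
have fM : M%:E \is a fin_num by [].
by rewrite -[LHS](addeK _ fM) sumE addeAC subee// add0e.
Qed.

Lemma second_moment_normal :
  (\int[normal_prob 0 s]_x (x ^+ 2)%:E = (s ^+ 2)%:E)%E.
Proof.
have pN x : p (- x) = p x by rewrite !normal_pdf0E sqrrN.
have cp : continuous p by exact: continuous_normal_pdf.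
rewrite ge0_integral_normal_prob//; last 2 first.
  by apply/measurable_EFinP; exact: measurable_funX.
  by move=> x; rewrite lee_fin sqr_ge0.
under eq_integral do rewrite -EFinM.
rewrite ge0_symfun_integralT//; last 3 first.
  by move=> x; rewrite mulr_ge0 ?sqr_ge0 ?normal_pdf_ge0.
  by move=> x; apply: cvgM; [exact: sqr_continuous|exact: cp].
  by move=> x /=; rewrite sqrrN pN.
rewrite -set_itvcy half_second_moment_normal muleCA set_itvcy.
rewrite -ge0_symfun_integralT//; last 2 first.
  by move=> x; exact: normal_pdf_ge0.
  by move=> x /=; rewrite pN.
by rewrite integral_normal_pdf mule1.
Qed.

Lemma integrable_sqr_normal_prob :
  (normal_prob 0 s).-integrable setT (fun x => (x ^+ 2)%:E).
Proof.
apply/integrableP; split.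
  by apply/measurable_EFinP; exact: measurable_funX.
under eq_integral do rewrite gee0_abs ?lee_fin ?sqr_ge0//.
by rewrite second_moment_normal ltry.
Qed.

(** Reflection gives the positive and negative parts the same integral; their difference is 0
    because that integral is finite, by domination by [1 + x ^+ 2]. *)
Lemma first_moment_normal :
  (\int[normal_prob 0 s]_x x%:E = 0)%E.
Proof.
have pN x : p (- x) = p x by rewrite !normal_pdf0E sqrrN.
have half (h : R -> R) : measurable_fun setT h -> (forall x, 0 <= h x) ->
    (\int[normal_prob 0 s]_x (h (- x))%:E = \int[normal_prob 0 s]_x (h x)%:E)%E.
  move=> mh h0.
  have mN : measurable_fun setT (-%R : R -> R).
    exact: oppr_measurable.
  have meh : measurable_fun setT (fun x => (h x)%:E).
    by apply/measurable_EFinP; exact: mh.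
  have mehN : measurable_fun setT (fun x : R => (h (- x))%:E).
    by apply/measurable_EFinP; exact: (measurableT_comp mh mN).
  have eh0 (x : R) : (0 <= (h x)%:E)%E by rewrite lee_fin.
  rewrite !ge0_integral_normal_prob//.
  have mhp : measurable_fun setT (fun x => ((h x)%:E * (p x)%:E)%E).
    apply: emeasurable_funM; first exact: meh.
    by apply/measurable_EFinP; exact: measurable_normal_pdf.
  transitivity (\int[pushforward mu (-%R : R -> measurableTypeR R)]_x
      ((h x)%:E * (p x)%:E))%E; last first.
    by apply: eq_measure_integral => A mA _; exact: lebesgue_measureN.
  rewrite ge0_integral_pushforward//; last first.
    by move=> x _; rewrite mule_ge0 ?lee_fin ?normal_pdf_ge0.
  by rewrite preimage_setT; apply: eq_integral => x _; rewrite /= pN.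
rewrite integralE.
rewrite (_ : (fun x : R => x%:E)^\- = (fun x => (Num.max (- x) 0)%:E))%E; last first.
  by apply/funext => x; rewrite funeneg.unlock/= EFin_max EFinN.
rewrite (_ : (fun x : R => x%:E)^\+ = (fun x => (Num.max x 0)%:E))%E; last first.
  by apply/funext => x; rewrite funepos.unlock/= EFin_max.
rewrite (half (fun x => Num.max x 0)).
- rewrite subee//.
  apply: integrable_fin_num => //.
  apply: (@le_integrable _ _ _ (normal_prob 0 s) setT measurableT _
    (fun x : R => 1%:E + (x ^+ 2)%:E)%E); last first.
  - apply: integrableD => //; last exact: integrable_sqr_normal_prob.
    exact: finite_measure_integrable_cst.
  - move=> x _ /=; rewrite lee_fin !ger0_norm ?addr_ge0 ?sqr_ge0 ?le_max ?lexx ?orbT//.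
    by rewrite ge_max; apply/andP; split; have := sqr_ge0 (x - 1); nra.
  - by apply/measurable_EFinP; exact: measurable_maxr.
- exact: measurable_maxr.
- by move=> x; rewrite le_max lexx orbT.
Qed.

End NormalMoments.

(** * Frobenius norms, semidefinite forms and the Rayleigh quotient *)

Section LinearAlgebra.
Context {R : realType}.

Lemma fnormE p q (A : 'M[R]_(p, q)) : fnorm A ^+ 2 = \sum_i \sum_j A i j ^+ 2.
Proof.
by rewrite sqr_sqrtr// sumr_ge0// => i _; rewrite sumr_ge0// => j _; exact: sqr_ge0.
Qed.

Lemma fnorm_cvE p (v : 'cV[R]_p) : fnorm v ^+ 2 = \sum_i v i 0 ^+ 2.
Proof. by rewrite fnormE; apply: eq_bigr => i _; rewrite big_ord1. Qed.

Lemma fnorm_trace p q (A : 'M[R]_(p, q)) : fnorm A ^+ 2 = \tr (A^T *m A).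
Proof.
rewrite fnormE exchange_big; apply: eq_bigr => j _ /=.
by rewrite mxE; apply: eq_bigr => i _; rewrite mxE expr2.
Qed.

Lemma fnorm_sum_col p q (A : 'M[R]_(p, q)) :
  fnorm A ^+ 2 = \sum_j fnorm (col j A) ^+ 2.
Proof.
rewrite fnormE exchange_big; apply: eq_bigr => j _ /=.
by rewrite fnorm_cvE; apply: eq_bigr => i _; rewrite mxE.
Qed.

Lemma fnorm_eq0 p (v : 'cV[R]_p) : fnorm v ^+ 2 = 0 -> v = 0.
Proof.
rewrite fnorm_cvE => /psumr_eq0P v0; apply/matrixP => i j; rewrite ord1 mxE.
by apply/eqP; rewrite -sqrf_eq0 v0// => k _; exact: sqr_ge0.
Qed.

Lemma fnorm_mul_le p q r (A : 'M[R]_(p, q)) (B : 'M[R]_(q, r)) :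
  fnorm (A *m B) ^+ 2 <= fnorm A ^+ 2 * fnorm B ^+ 2.
Proof.
have cs n (x y : 'I_n -> R) :
    (\sum_i x i * y i) ^+ 2 <= (\sum_i x i ^+ 2) * (\sum_i y i ^+ 2).
  set X := \sum_i x i ^+ 2; set Z := \sum_i y i ^+ 2; set W := \sum_i x i * y i.
  have h c d : 0 <= c ^+ 2 * X - 2 * c * d * W + d ^+ 2 * Z.
    have -> : c ^+ 2 * X - 2 * c * d * W + d ^+ 2 * Z =
        \sum_i (c * x i - d * y i) ^+ 2.
      rewrite !mulr_sumr -sumrN -!big_split/=.
      by apply: eq_bigr => i _; ring.
    by apply: sumr_ge0 => i _; exact: sqr_ge0.
  have X0 : 0 <= X by apply: sumr_ge0 => i _; exact: sqr_ge0.
  have Z0 : 0 <= Z by apply: sumr_ge0 => i _; exact: sqr_ge0.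
  have [Zz|Zn] := eqVneq Z 0.
    (* When [Z = 0] these coefficients turn the form into [- W ^+ 2], so [W] vanishes. *)
    have := h W ((X + 1) / 2); rewrite Zz.
    have -> : W ^+ 2 * X - 2 * W * ((X + 1) / 2) * W + ((X + 1) / 2) ^+ 2 * 0 =
      - W ^+ 2 by field.
    by lra.
  have Zp : 0 < Z by rewrite lt_def Zn.
  have := h Z W; have -> : Z ^+ 2 * X - 2 * Z * W * W + W ^+ 2 * Z =
    Z * (X * Z - W ^+ 2) by ring.
  by rewrite pmulr_rge0// subr_ge0.
rewrite [in leLHS]fnormE [fnorm A ^+ 2]fnormE [fnorm B ^+ 2]fnormE.
rewrite [X in _ <= _ * X]exchange_big/= mulr_suml.
apply: ler_sum => i _; rewrite mulr_sumr; apply: ler_sum => j _.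
by rewrite mxE; exact: cs.
Qed.

Lemma fnorm_tr p q (A : 'M[R]_(p, q)) : fnorm A^T = fnorm A.
Proof.
rewrite /fnorm exchange_big; congr Num.sqrt; apply: eq_bigr => i _.
by apply: eq_bigr => j _; rewrite mxE.
Qed.

Lemma fnorm_isometry k d q (U : 'M[R]_(k, d)) (B : 'M[R]_(k, q)) :
  U *m U^T = 1%:M -> fnorm (U^T *m B) ^+ 2 = fnorm B ^+ 2.
Proof.
by move=> UU; rewrite !fnorm_trace trmx_mul trmxK mulmxA -(mulmxA B^T) UU mulmx1.
Qed.

Lemma fnorm_pythagoras k d q (U : 'M[R]_(k, d)) (A : 'M[R]_(d, q)) :
  U *m U^T = 1%:M ->
  fnorm (U *m A) ^+ 2 + fnorm (A - U^T *m (U *m A)) ^+ 2 = fnorm A ^+ 2.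
Proof.
move=> UU.
have UUA : (U^T *m (U *m A))^T *m (U^T *m (U *m A)) = (U *m A)^T *m (U *m A).
  by rewrite trmx_mul trmxK mulmxA -(mulmxA _ U) UU mulmx1.
rewrite !fnorm_trace (linearB (@trmx _ _ _))/= mulmxBl !mulmxBr UUA.
rewrite !raddfB/=.
have -> : A^T *m (U^T *m (U *m A)) = (U *m A)^T *m (U *m A).
  by rewrite trmx_mul mulmxA.
have -> : (U^T *m (U *m A))^T *m A = (U *m A)^T *m (U *m A).
  by rewrite [in LHS]trmx_mul trmxK mulmxA.
by ring.
Qed.

(** [(U + V) *m (U + V)^T = 1 + V *m V^T], so the old basis and its increment contribute separately,
    with no mixed term. *)
Lemma fnorm_orthogonal_add k d q (U V : 'M[R]_(k, d)) (B : 'M[R]_(k, q)) :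
  U *m U^T = 1%:M -> V *m U^T = 0 ->
  fnorm ((U + V)^T *m B) ^+ 2 = fnorm B ^+ 2 + fnorm (V^T *m B) ^+ 2.
Proof.
move=> UU VU.
have UV : U *m V^T = 0 by rewrite -[U]trmxK -trmx_mul VU trmx0.
rewrite !fnorm_trace -raddfD/= !trmx_mul !trmxK.
rewrite (linearD (@trmx _ _ _))/= -!mulmxA -mulmxDr; congr (\tr (_ *m _)).
rewrite mulmxA mulmxDl !mulmxDr UU VU UV addr0 add0r.
by rewrite mulmxDl mul1mx mulmxA.
Qed.

Lemma trivial_kernel_unitmx n (A : 'M[R]_n) :
  (forall v : 'cV[R]_n, A *m v = 0 -> v = 0) -> A \in unitmx.
Proof.
move=> ker0; rewrite -unitmx_tr -row_free_unit -kermx_eq0 -submx0.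
apply/rV_subP => v /sub_kermxP vA.
have vT0 : v^T = 0 by apply: ker0; rewrite -[A]trmxK -trmx_mul vA trmx0.
by rewrite -[v]trmxK vT0 trmx0 sub0mx.
Qed.

(* With [v = Rq *m y], Cauchy-Schwarz gives
   [|v| ^+ 2 = (Rq^T *m v) . y <= |Rq^T *m v| * |y| <= |Rq^T *m v| * |v|]. *)
Lemma expansive_trmx k d (Rq : 'M[R]_k) (V : 'M[R]_(k, d)) (v : 'cV[R]_k) :
  Rq^T *m Rq = 1%:M + V *m V^T -> fnorm v ^+ 2 <= fnorm (Rq^T *m v) ^+ 2.
Proof.
move=> RR.
have expand (y : 'cV[R]_k) : fnorm y ^+ 2 <= fnorm (Rq *m y) ^+ 2.
  have -> : fnorm (Rq *m y) ^+ 2 = fnorm y ^+ 2 + fnorm (V^T *m y) ^+ 2.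
    rewrite !fnorm_trace !trmx_mul trmxK -raddfD/= mulmxA -(mulmxA _ _ Rq) RR.
    by rewrite mulmxDr mulmx1 mulmxDl !mulmxA.
  by rewrite lerDl sqr_ge0.
have Runit : Rq \in unitmx.
  apply: trivial_kernel_unitmx => y Ry0; apply: fnorm_eq0.
  apply/eqP; rewrite eq_le sqr_ge0 andbT (le_trans (expand y))// Ry0.
  by rewrite fnorm_cvE big1// => i _; rewrite mxE expr0n.
set w := Rq^T *m v; pose y := invmx Rq *m v.
have vE : v = Rq *m y by rewrite mulKVmx.
have wy : 2 * fnorm v ^+ 2 <= fnorm w ^+ 2 + fnorm y ^+ 2.
  have -> : fnorm v ^+ 2 = \sum_i w i 0 * y i 0.
    transitivity ((w^T *m y) 0 0); last first.
      by rewrite mxE; apply: eq_bigr => i _; rewrite mxE.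
    rewrite trmx_mul trmxK -mulmxA -vE mxE fnorm_cvE.
    by apply: eq_bigr => i _; rewrite mxE.
  rewrite !fnorm_cvE mulr_sumr -big_split/=; apply: ler_sum => i _.
  by have := sqr_ge0 (w i 0 - y i 0); nra.
by have := expand y; rewrite -vE; lra.
Qed.

Lemma quadratic_form_sub n (A : 'M[R]_n) c (v : 'cV[R]_n) :
  (v^T *m (A - c%:M) *m v) 0 0 = (v^T *m A *m v) 0 0 - c * fnorm v ^+ 2.
Proof.
rewrite mulmxBr mulmxBl mul_mx_scalar -scalemxAl !mxE fnorm_cvE.
by congr (_ - c * _); apply: eq_bigr => i _; rewrite mxE expr2.
Qed.

(** A zero of a nonnegative form is a minimum: along the direction [w = B *m u] the first-order
    change [2 * t * |w| ^+ 2] must vanish. *)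
Lemma psd_null_vector n (B : 'M[R]_n) (u : 'cV[R]_n) :
  psd B -> (u^T *m B *m u) 0 0 = 0 -> B *m u = 0.
Proof.
move=> [Bsym Bpos] u0; set w := B *m u; apply: fnorm_eq0.
have wE : (w^T *m B *m u) 0 0 = fnorm w ^+ 2.
  rewrite -mulmxA -/w mxE fnorm_cvE.
  by apply: eq_bigr => i _; rewrite mxE expr2.
have wE' : (u^T *m B *m w) 0 0 = fnorm w ^+ 2.
  have -> : u^T *m B *m w = (w^T *m B *m u)^T.
    by rewrite trmx_mul (trmx_mul w^T) trmxK Bsym mulmxA.
  by rewrite mxE.
pose c := (w^T *m B *m w) 0 0.
have h t : 0 <= 2 * t * fnorm w ^+ 2 + t ^+ 2 * c.
  have := Bpos (u + t *: w).
  have -> : (u + t *: w)^T *m B *m (u + t *: w) =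
      u^T *m B *m u + t *: (u^T *m B *m w) +
      (t *: (w^T *m B *m u) + t *: (t *: (w^T *m B *m w))).
    rewrite [(u + _)^T]linearD/= [(t *: w)^T]linearZ/= mulmxDl mulmxDl !mulmxDr.
    by rewrite -!scalemxAl -!scalemxAr.
  have mxD (x y : 'M[R]_1) : (x + y) 0 0 = x 0 0 + y 0 0 by rewrite mxE.
  have mxZ b (x : 'M[R]_1) : (b *: x) 0 0 = b * x 0 0 by rewrite mxE.
  rewrite !mxD !mxZ u0 wE wE' -/c.
  have -> : 0 + t * fnorm w ^+ 2 + (t * fnorm w ^+ 2 + t * (t * c)) =
    2 * t * fnorm w ^+ 2 + t ^+ 2 * c by ring.
  by [].
apply/eqP; rewrite eq_le sqr_ge0 andbT.
have c0 : 0 <= c by exact: Bpos.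
have f0 := sqr_ge0 (fnorm w).
(* Dividing by [c + 1] instead of [c], which would give the exact minimiser, also covers [c = 0]. *)
have := h (- (fnorm w ^+ 2) / (c + 1)).
have cp : 0 < c + 1 by lra.
have -> : 2 * (- fnorm w ^+ 2 / (c + 1)) * fnorm w ^+ 2 +
   (- fnorm w ^+ 2 / (c + 1)) ^+ 2 * c =
   - ((fnorm w ^+ 2) ^+ 2 * (c + 2) / (c + 1) ^+ 2).
  by field; rewrite gt_eqF.
rewrite oppr_ge0 => h1.
have : (fnorm w ^+ 2) ^+ 2 * (c + 2) <= 0.
  by rewrite -(pmulr_lle0 _ (_ : 0 < ((c + 1) ^+ 2)^-1))// invr_gt0 exprn_gt0.
rewrite pmulr_lle0; last by lra.
move=> h2; have : (fnorm w ^+ 2) ^+ 2 = 0.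
  by apply/eqP; rewrite eq_le h2 sqr_ge0.
by move=> /eqP; rewrite sqrf_eq0 => /eqP->.
Qed.

Lemma continuous_sum (T : topologicalType) I (r : seq I) (f : I -> T -> R) :
  (forall i, continuous (f i)) -> continuous (fun x => \sum_(i <- r) f i x).
Proof.
move=> cf; elim: r => [|i r ih].
  rewrite (_ : (fun x => _) = cst 0); first exact: cst_continuous.
  by apply/funext => x; rewrite big_nil.
rewrite (_ : (fun x => _) = f i + (fun x => \sum_(j <- r) f j x)); last first.
  by apply/funext => x; rewrite big_cons.
by move=> x; apply: continuousD; [exact: cf|exact: ih].
Qed.

(* The minimum of the Rayleigh quotient over the unit sphere is an eigenvalue. *)
Lemma rayleigh_smallest_eigenvalue n (C : 'M[R]_n) s (v : 'cV[R]_n) :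
  C^T = C -> smallest_eigenvalue C s ->
  s * fnorm v ^+ 2 <= (v^T *m C *m v) 0 0.
Proof.
case: n C v => [|n] C v Csym [_ smin].
  by rewrite fnorm_cvE big_ord0 mulr0 mxE big_ord0.
pose S : set 'rV[R]_n.+1 := [set u | \sum_i u 0 i ^+ 2 = 1].
pose q (u : 'rV[R]_n.+1) := \sum_i (\sum_j u 0 j * C j i) * u 0 i.
have qE (u : 'rV[R]_n.+1) : (u *m C *m u^T) 0 0 = q u.
  by rewrite mxE; apply: eq_bigr => i _; rewrite !mxE.
have coordc i : continuous (fun u : 'rV[R]_n.+1 => u 0 i) by exact: coord_continuous.
have cN : continuous (fun u : 'rV[R]_n.+1 => \sum_i u 0 i ^+ 2).
  by apply: continuous_sum => i u; apply: continuousM; exact: coordc.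
have cq : continuous q.
  apply: continuous_sum => i u; apply: continuousM; last exact: coordc.
  apply: continuous_sum => j {}u; apply: continuousM; first exact: coordc.
  exact: cst_continuous.
have S0 : S !=set0.
  exists (delta_mx 0 0); rewrite /S/= (bigD1 0)//= mxE !eqxx expr1n big1 ?addr0//.
  by move=> i i0; rewrite mxE (negbTE i0) andbF expr0n.
have Scl : closed S.
  rewrite (_ : S = (fun u : 'rV[R]_n.+1 => \sum_i u 0 i ^+ 2) @^-1` [set 1])//.
  apply: preimage_closed => //; exact: closed_eq.
(* Boundedness is in the sup norm, while [S] is the Euclidean sphere: its points have coordinates of
   absolute value at most 1. *)
have Sb : bounded_set S.
  exists 1; split => // M M1 u Su; rewrite /= [leLHS]/Num.Def.normr/= mx_normrE.
  apply: bigmax_le => [|i _]; first by rewrite ltW// (lt_trans _ M1).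
  rewrite (le_trans _ (ltW M1))// -(@ler_pXn2r _ 2)// ?nnegrE//.
  rewrite expr1n real_normK ?num_real// -Su (bigD1 i.2)//= ord1.
  by rewrite lerDl sumr_ge0// => j _; exact: sqr_ge0.
have [u uS umin] := EVT_min_rV S0 (bounded_closed_compact Sb Scl)
  (continuous_subspaceT cq).
move/set_mem: uS => uS.
have nE (w : 'rV[R]_n.+1) : fnorm w^T ^+ 2 = \sum_i w 0 i ^+ 2.
  by rewrite fnorm_cvE; apply: eq_bigr => i _; rewrite mxE.
(* Minimality of [u] makes [B] positive semidefinite with [u] a zero of its form, so
   [psd_null_vector] shows that [u] is an eigenvector of [C]. *)
pose B := C - (q u)%:M.
have Bpsd : psd B.
  split; first by rewrite linearB/= tr_scalar_mx Csym.
  move=> w; rewrite quadratic_form_sub subr_ge0.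
  have [w0|w0] := eqVneq (fnorm w ^+ 2) 0.
    by rewrite w0 mulr0 (fnorm_eq0 w0) mulmx0 mxE.
  have wp : 0 < fnorm w by rewrite lt_def sqrtr_ge0 andbT -sqrf_eq0.
  pose x := (fnorm w)^-1 *: w^T.
  have xS : S x.
    rewrite /S/= -nE fnorm_cvE.
    under eq_bigr do rewrite !mxE exprMn.
    by rewrite -mulr_sumr -fnorm_cvE exprVn mulVf.
  have := umin x (mem_set xS).
  have -> : q x = (fnorm w ^+ 2)^-1 * (w^T *m C *m w) 0 0.
    rewrite -(qE x).
    have -> : x *m C *m x^T = (fnorm w)^-1 ^+ 2 *: (w^T *m C *m w).
      by rewrite /x linearZ/= trmxK -!scalemxAl -scalemxAr scalerA expr2.
    by rewrite mxE exprVn.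
  by rewrite ler_pdivlMl ?exprn_gt0// mulrC.
have Bu : (u^T^T *m B *m u^T) 0 0 = 0.
  by rewrite quadratic_form_sub trmxK qE nE uS mulr1 subrr.
have := psd_null_vector Bpsd Bu; rewrite mulmxBl mul_scalar_mx => /eqP.
rewrite subr_eq0 => /eqP Cu.
have sq : s <= q u.
  (* [eigenvalue] refers to row vectors acting from the left, hence the transposition and the
     symmetry of [C]. *)
  apply: smin; apply/eigenvalueP; exists u.
    by apply: trmx_inj; rewrite trmx_mul Csym Cu linearZ.
  apply/eqP => u0; move: uS; rewrite /S/= u0 big1 => [/eqP|i _].
    by rewrite eq_sym oner_eq0.
  by rewrite mxE expr0n.
have := Bpsd.2 v; rewrite quadratic_form_sub subr_ge0; apply: le_trans.
by rewrite ler_wpM2r// sqr_ge0.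
Qed.

End LinearAlgebra.

(** * Borel sets of matrices and measurability by entries *)

Section MatrixMeasurability.
Context {R : realType}.

(** Second countability in a form suited to preimages: the balls of rational centre and radius
    [1 / (n + 1)] inside [B], written entry by entry. *)
Lemma open_matrix_bigcup_rat p q (B : set 'M[R]_(p, q)) : open B ->
  B = \bigcup_(x : 'M[rat]_(p, q) * nat)
        [set M | (forall i j, `|ratr (x.1 i j) - M i j| < x.2.+1%:R^-1 :> R) /\
                 ball (map_mx ratr x.1 : 'M[R]_(p, q)) (x.2.+1%:R^-1 : R) `<=` B].
Proof.
move=> oB; apply/seteqP; split; last first.
  move=> M [x _ [xM]]; apply; split => //.
  by move=> i j; rewrite mxE; exact: xM.
move=> M BM; have /nbhs_ballP[e /= e0 eB] : nbhs M B by exact: open_nbhs_nbhs.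
(* Half of [e], because a point of the rational ball is compared with [M] through the centre. *)
have [n ne] : exists n, n.+1%:R^-1 < e / 2 :> R.
  have e2 : 0 < e / 2 by rewrite divr_gt0.
  have := @near_infty_natSinv_lt R (PosNum e2).
  by move=> [n _ nP]; exists n; have := nP n (leqnn n).
have n0 : 0 < n.+1%:R^-1 :> R by rewrite invr_gt0.
have /choice[c cP] : forall ij : 'I_p * 'I_q, exists r : rat,
    `|ratr r - M ij.1 ij.2| < n.+1%:R^-1 :> R.
  move=> ij; have /rat_in_itvoo[r] : M ij.1 ij.2 - n.+1%:R^-1 < M ij.1 ij.2 + n.+1%:R^-1 :> R.
    by rewrite ltrD2l (lt_trans _ n0)// oppr_lt0.
  by rewrite in_itv/= => h; exists r; rewrite ltr_distl.
exists (\matrix_(i, j) c (i, j), n) => //=; split.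
  by move=> i j; rewrite mxE; exact: (cP (i, j)).
move=> M' [_ MM']; apply: eB; split => // i j.
have := MM' i j; have := cP (i, j); rewrite !mxE /ball/= => h1 h2.
rewrite -(subrKA (ratr (c (i, j)))) (le_lt_trans (ler_normD _ _))//.
rewrite (splitr e) ltrD//; last exact: lt_trans ne.
by rewrite distrC; exact: lt_trans ne.
Qed.

Lemma measurable_coord p q (i : 'I_p) (j : 'I_q) :
  measurable_fun setT ((fun M => M i j) : @borelM R p q -> R).
Proof.
apply: (measurability _ (RGenOpens.measurableE R)) => _ [_ [a [b ->]] <-].
rewrite setTI; apply: sub_sigma_algebra.
apply: open_comp; last exact: interval_open.
by move=> M _; exact: coord_continuous.
Qed.

Lemma measurable_matrixP d (T : measurableType d) p q (X : T -> 'M[R]_(p, q)) :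
  measurable_fun setT (X : T -> @borelM R p q) <->
  forall i j, measurable_fun setT (fun x => X x i j).
Proof.
split=> [mX i j|mX].
  exact: (measurableT_comp (measurable_coord i j) mX).
apply: (@measurability _ _ T (@borelM R p q) setT X
  [set B : set 'M[R]_(p, q) | open B]) => // _ [B oB <-]; rewrite setTI.
rewrite (open_matrix_bigcup_rat oB) preimage_bigcup.
apply: countable_bigcupT_measurable; first exact: countableP.
move=> [c n] /=.
have [cB|ncB] := pselect (ball (map_mx ratr c : 'M[R]_(p, q)) (n.+1%:R^-1 : R) `<=` B);
    last first.
  by rewrite (_ : _ @^-1` _ = set0)//; apply/seteqP; split => // x [].
rewrite (_ : _ @^-1` _ = \bigcap_(ij in [set: 'I_p * 'I_q])
    ((fun x => X x ij.1 ij.2) @^-1` ball (ratr (c ij.1 ij.2) : R) n.+1%:R^-1)).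
  apply: fin_bigcap_measurable; first exact: finite_finset.
  move=> [i j] _; rewrite -[X in measurable X]setTI; apply: mX => //.
  by apply: open_measurable; exact: ball_open.
apply/seteqP; split=> [x [xc _] [i j] _|x xc]; first exact: xc.
by split => // i j; exact: (xc (i, j)).
Qed.

End MatrixMeasurability.

(** * Measurability with respect to a sub-sigma-algebra *)

Section SubSigmaAlgebra.
Context {R : realType} {dO : measure_display} {Omega : measurableType dO}.
Implicit Types (G : set (set Omega)) (f : Omega -> R).

(** Retyping the domain with the sigma-algebra generated by [G] lets the closure properties of
    measurable functions apply verbatim. *)
Definition measurable_rv G f :=
  measurable_fun [set: g_sigma_algebraType G] (f : g_sigma_algebraType G -> R).

Lemma measurable_rvP G f : sigma_algebra setT G ->
  measurable_rv G f <-> forall B : set R, measurable B -> G (f @^-1` B).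
Proof.
move=> sG; have GE := measurable_g_measurableTypeE sG; split => mf.
  by move=> B mB; rewrite -GE -[X in measurable X]setTI; exact: mf.
by move=> _ B mB; rewrite setTI GE; exact: mf.
Qed.

Lemma measurable_wrtP G p q (X : Omega -> 'M[R]_(p, q)) : sigma_algebra setT G ->
  measurable_wrt G X <-> forall i j, measurable_rv G (fun w => X w i j).
Proof.
move=> sG; have GE := measurable_g_measurableTypeE sG.
rewrite /measurable_rv -(@measurable_matrixP R _ (g_sigma_algebraType G)).
split=> mX.
  by move=> _ B mB; rewrite setTI GE; exact: mX.
by move=> B mB; rewrite -GE -[X in measurable X]setTI; exact: mX.
Qed.

Lemma measurable_rv_mono G G' f : sigma_algebra setT G -> sigma_algebra setT G' ->
  G `<=` G' -> measurable_rv G f -> measurable_rv G' f.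
Proof.
move=> sG sG' GG' /(measurable_rvP _ sG) mf; apply/(measurable_rvP _ sG') => B mB.
exact/GG'/mf.
Qed.

Lemma measurable_rv_measurable G f : sigma_algebra setT G ->
  G `<=` measurable -> measurable_rv G f -> measurable_fun setT f.
Proof.
by move=> sG GG' /(measurable_rvP _ sG) mf _ B mB; rewrite setTI; exact/GG'/mf.
Qed.

Lemma measurable_rvM G f g : measurable_rv G f -> measurable_rv G g ->
  measurable_rv G (fun w => f w * g w).
Proof. exact: measurable_funM. Qed.

Lemma measurable_rvD G f g : measurable_rv G f -> measurable_rv G g ->
  measurable_rv G (fun w => f w + g w).
Proof. exact: measurable_funD. Qed.

Lemma measurable_rvB G f g : measurable_rv G f -> measurable_rv G g ->
  measurable_rv G (fun w => f w - g w).
Proof. exact: measurable_funB. Qed.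

Lemma measurable_rv_sum G I (r : seq I) (h : I -> Omega -> R) :
  (forall i, measurable_rv G (h i)) ->
  measurable_rv G (fun w => \sum_(i <- r) h i w).
Proof. by move=> mh; exact: measurable_sum. Qed.

Lemma measurable_rv_mulmx G p q r (X : Omega -> 'M[R]_(p, q))
    (Z : Omega -> 'M[R]_(q, r)) :
  (forall i j, measurable_rv G (fun w => X w i j)) ->
  (forall i j, measurable_rv G (fun w => Z w i j)) ->
  forall i j, measurable_rv G (fun w => (X w *m Z w) i j).
Proof.
move=> mX mZ i j; under [X in measurable_rv _ X]eq_fun do rewrite mxE.
by apply: measurable_rv_sum => l; exact: measurable_rvM.
Qed.

Lemma measurable_rv_cst G c : measurable_rv G (fun=> c).
Proof. exact: measurable_cst. Qed.

(** Time is frozen by composing with the map from [w] to [(t, X w)]. The preimage is taken inside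
    the half-space of nonnegative times, and [0 <= t] makes that restriction invisible. *)
Lemma measurable_rv_coefficient G d p q (f : R -> 'cV[R]_d -> 'M[R]_(p, q))
    (t : R) (X : Omega -> 'cV[R]_d) : 0 <= t -> borel_coefficient f ->
  (forall i j, measurable_rv G (fun w => X w i j)) ->
  forall i j, measurable_rv G (fun w => f t (X w) i j).
Proof.
move=> t0 mf mX.
have mtX : measurable_fun [set: g_sigma_algebraType G]
    ((fun w => (t, X w)) : g_sigma_algebraType G -> measurableTypeR R * @borelM R d 1).
  apply: measurable_fun_pair; first exact: measurable_cst.
  by apply/(@measurable_matrixP R _ (g_sigma_algebraType G)).
apply/(@measurable_matrixP R _ (g_sigma_algebraType G)).
move=> _ B mB; rewrite setTI.
have m0 : measurable [set z : measurableTypeR R * @borelM R d 1 | 0 <= z.1].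
  rewrite (_ : [set z | _] = setT `&` fst @^-1` `[0, +oo[%classic); last first.
    by apply/seteqP; split=> z /=; rewrite in_itv/= andbT => // -[].
  exact: measurable_fst.
have := mtX measurableT _ (mf m0 _ mB); rewrite setTI.
by congr (measurable _); apply/seteqP; split => w /=; [case|].
Qed.

End SubSigmaAlgebra.

(** * Brownian increments as white noise *)

Section BrownianNoise.
Context {R : realType} {dO : measure_display} {Omega : measurableType dO}.
Variable P : probability Omega R.
Variables (F : R -> set (set Omega)) (m : nat) (W : R -> Omega -> 'cV[R]_m).
Hypotheses (hF : usual_filtration P F) (hW : brownian_motion P F W).
Variables s t : R.
Hypotheses (s0 : 0 <= s) (st : s < t).

Let t0 : 0 <= t. Proof. by rewrite (le_trans s0)// ltW. Qed.

Let sgF u : 0 <= u -> sigma_algebra setT (F u).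
Proof. exact: uf_sigma_algebra hF u. Qed.

Let xi (j : 'I_m) w := W t w j 0 - W s w j 0.

Let sd := Num.sqrt (t - s).

Let sd0 : 0 < sd. Proof. by rewrite sqrtr_gt0 subr_gt0. Qed.

Let sd2 : sd ^+ 2 = t - s. Proof. by rewrite sqr_sqrtr// subr_ge0 ltW. Qed.

Lemma measurable_rv_increment j : measurable_rv (F t) (xi j).
Proof.
apply: measurable_rvB.
  exact: ((measurable_wrtP _ (sgF t0)).1 (bm_adapted hW t0)).
apply: (measurable_rv_mono (sgF s0) (sgF t0)).
  exact: (uf_monotone hF s0 (ltW st)).
exact: ((measurable_wrtP _ (sgF s0)).1 (bm_adapted hW s0)).
Qed.

Let mxi j : measurable_fun setT (xi j).
Proof.
apply: (measurable_rv_measurable (sgF t0)); first exact: uf_sub hF t t0.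
exact: measurable_rv_increment.
Qed.

Let law (B : 'I_m -> set R) : (forall i, measurable (B i)) ->
  (P (\bigcap_(i in [set: 'I_m]) (xi i @^-1` B i)) =
   \prod_(i < m) normal_prob 0%R sd (B i))%E.
Proof.
move=> mB; rewrite -(bm_gaussian hW s0 st mB); congr (P _).
by apply/seteqP; split=> [w h i|w h i _]; exact: h.
Qed.

Let law1 i (A : set R) : measurable A -> P (xi i @^-1` A) = normal_prob 0 sd A.
Proof.
(* Full events in the other coordinates turn the joint law into a marginal one. *)
move=> mA; pose B l : set R := if l == i then A else setT.
have mB l : measurable (B l) by rewrite /B; case: ifP.
have := law mB; rewrite (bigD1 i)//= {2}/B eqxx big1 ?mule1; last first.
  by move=> l li; rewrite /B (negbTE li) probability_setT.
move=> <-; congr (P _); apply/seteqP; split=> [w wA l _|w /(_ i Logic.I)].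
  by rewrite /B; case: eqVneq => [->|].
by rewrite /B eqxx.
Qed.

Let law2 i j (A A' : set R) : i != j -> measurable A -> measurable A' ->
  P (xi i @^-1` A `&` xi j @^-1` A') = (P (xi i @^-1` A) * P (xi j @^-1` A'))%E.
Proof.
move=> ij mA mA'.
pose B l : set R := if l == i then A else if l == j then A' else setT.
have mB l : measurable (B l) by rewrite /B; do 2 case: ifP => //.
have := law mB; rewrite (bigD1 i)//= (bigD1 j)/=; last by rewrite eq_sym.
rewrite {2}/B eqxx {2}/B eq_sym (negbTE ij) eqxx big1 ?mule1; last first.
  by move=> l /andP[li lj]; rewrite /B (negbTE li) (negbTE lj) probability_setT.
rewrite -(law1 i mA) -(law1 j mA') => <-; congr (P _).
apply/seteqP; split=> [w [wA wA'] l _|w h].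
  by rewrite /B; case: eqVneq => [->//|_]; case: eqVneq => [->|].
split; first by have := h i Logic.I; rewrite /B /= eqxx.
by have := h j Logic.I; rewrite /B /= eq_sym (negbTE ij) eqxx.
Qed.

(* The laws of the library live on [measurableTypeR R], which has the same
   measurable sets as [R] but another display. *)
Let mxiR i : measurable_fun setT (xi i : Omega -> measurableTypeR R).
Proof. exact: mxi. Qed.

Let xiM i : {mfun Omega >-> measurableTypeR R} :=
  @mfun_Sub _ _ Omega (measurableTypeR R) _ (mem_set (mxiR i)).

Let integral_lawE i (f : R -> \bar R) :
  (\int[distribution P (xiM i)]_x f x = \int[normal_prob 0 sd]_x f x)%E.
Proof. by apply: eq_measure_integral => A mA _; exact: (law1 i). Qed.

Let xi2 i : (\int[P]_w (xi i w ^+ 2)%:E = (t - s)%:E)%E.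
Proof.
rewrite -sd2 -second_moment_normal// -(integral_lawE i).
rewrite ge0_integral_distribution//.
- by apply/measurable_EFinP; exact: measurable_funX.
- by move=> x; rewrite lee_fin sqr_ge0.
Qed.

Let sxi i : sqint P (xi i).
Proof.
split => //; apply/integrableP; split.
  by apply/measurable_EFinP; exact: measurable_funX.
under eq_integral do rewrite gee0_abs ?lee_fin ?sqr_ge0//.
by rewrite /= xi2 ltry.
Qed.

Let ixi i : P.-integrable setT (EFin \o xi i).
Proof.
apply: eq_integrable (sqint_mul (sxi i) (sqint_cst P 1)) => //.
by move=> w _; rewrite /= mulr1.
Qed.

Let Exi i : \int[P]_w xi i w = 0.
Proof.
rewrite /Rintegral.
have <- := integral_distribution (X := xiM i) (f := EFin) _ (ixi i).
  by rewrite integral_lawE first_moment_normal.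
exact/measurable_EFinP.
Qed.

Let Exixj i j : \int[P]_w (xi i w * xi j w) = (i == j)%:R * (t - s).
Proof.
have [->|ij] := eqVneq i j; first by rewrite mul1r /Rintegral xi2.
rewrite mul0r (independent_mul (ixi i) (ixi j) _).2 ?Exi ?mulr0//.
by move=> A B; exact: law2.
Qed.

(** Independence of the past from the vector increment passes to Borel functions of it, here a
    coordinate or a product of two. Expectations then factor and the Gaussian law supplies the
    moments. *)
Lemma brownian_noise : white_noise P (measurable_rv (F s)) (t - s) xi.
Proof.
have indep h (Z : 'cV[R]_m -> R) : measurable_rv (F s) h ->
    measurable_fun setT (Z : @borelM R m 1 -> R) ->
    forall A B : set R, measurable A -> measurable B ->
    P (h @^-1` A `&` (fun w => Z (W t w - W s w)%R) @^-1` B) =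
    (P (h @^-1` A) * P ((fun w => Z (W t w - W s w)%R) @^-1` B))%E.
  move=> mh mZ A B mA mB.
  have GA : F s (h @^-1` A) by apply: (measurable_rvP _ (sgF s0)).1.
  have mZB : measurable (Z @^-1` B : set (@borelM R m 1)).
    by rewrite -[X in measurable X]setTI; exact: mZ.
  exact: (bm_independent hW s0 st GA mZB).
have mc j : measurable_fun setT ((fun M => M j 0) : @borelM R m 1 -> R).
  exact: measurable_coord.
split; first exact: sxi.
  move=> h mh ih j.
  rewrite (independent_mul ih (ixi j) _).2 ?Exi ?mulr0// => A B mA mB.
  have := indep h _ mh (mc j) A B mA mB.
  rewrite (_ : (fun w => _) = xi j)//.
  by apply/funext => w; rewrite !mxE.
move=> h mh ih i j.
have ind : forall A B : set R, measurable A -> measurable B ->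
    P (h @^-1` A `&` (fun w => xi i w * xi j w) @^-1` B) =
    (P (h @^-1` A) * P ((fun w => xi i w * xi j w)%R @^-1` B))%E.
  move=> A B mA mB.
  have := indep h _ mh (measurable_funM (mc i) (mc j)) A B mA mB.
  rewrite (_ : (fun w => _) = (fun w => xi i w * xi j w))//.
  by apply/funext => w; rewrite /= !mxE.
have [i1 ->] := independent_mul ih (sqint_mul (sxi i) (sxi j)) ind.
by rewrite Exixj mulrC.
Qed.

End BrownianNoise.

(** * Scalar inequalities behind the step estimates *)

Section ScalarEstimates.
Context {R : realType}.
Implicit Types x a u Q L : R.

(** For [a <= Q] the right side is [a ^+ 2 + u ^+ 2 + 2 * u * (Q - a)]. For [Q < a], if [u <= Q]
    then lowering [a] to [Q] leaves [Q ^+ 2 + u ^+ 2], and if [u > Q] the term [2 * u * Q]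
    suffices. *)
Lemma shrunk_square_lower_bound a u Q L : 0 <= u -> u <= a -> 0 <= Q ->
  L <= a ^+ 2 -> L <= Q ^+ 2 -> L <= (a - u) ^+ 2 + 2 * u * Q.
Proof.
move=> u0 ua Q0 La LQ.
have [aQ|Qa] := leP a Q.
  have uQa : 0 <= u * (Q - a) by rewrite mulr_ge0// subr_ge0.
  by apply: (le_trans La); have := sqr_ge0 u; nra.
apply: (le_trans LQ).
have [uQ|Qu] := leP u Q.
  have : (Q - u) ^+ 2 <= (a - u) ^+ 2.
    by rewrite lerXn2r ?nnegrE ?subr_ge0// lerD2r ltW.
  by have := sqr_ge0 u; nra.
have : Q * Q <= u * Q by rewrite ler_wpM2r// ltW.
by have := sqr_ge0 (a - u); have := sqr_ge0 Q; nra.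
Qed.

(* [x + 2 * h * c + h ^+ 2 * p] is at least [(a - h * r) ^+ 2] for [a ^+ 2 = x]
   and [r ^+ 2 = A * nv]; the noise contributes
   [h * S * nv = 2 * (h * r) * Q] with [Q = S * r / (2 * A)]. *)
Lemma euler_step_lower_bound x p c nv A S h M :
  0 <= h -> 0 < A -> 0 <= S -> 0 <= nv -> 0 <= x -> 0 <= p ->
  c ^+ 2 <= x * p -> p <= A * nv -> h ^+ 2 * A * nv <= x -> M * nv <= x ->
  M <= S ^+ 2 / (4 * A) ->
  M * nv <= x + 2 * h * c + h ^+ 2 * p + h * S * nv.
Proof.
move=> h0 A0 S0 nv0 x0 p0 cxp pA hx Mx MS.
pose a := Num.sqrt x; pose b := Num.sqrt p; pose r := Num.sqrt (A * nv).
have Anv0 : 0 <= A * nv by rewrite mulr_ge0// ltW.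
have a2 : a ^+ 2 = x by exact: sqr_sqrtr.
have b2 : b ^+ 2 = p by exact: sqr_sqrtr.
have r2 : r ^+ 2 = A * nv by exact: sqr_sqrtr.
have a0 : 0 <= a by exact: sqrtr_ge0.
have b0 : 0 <= b by exact: sqrtr_ge0.
have r0 : 0 <= r by exact: sqrtr_ge0.
have br : b <= r by exact: ler_wsqrtr.
have hra : h * r <= a.
  rewrite -(@ler_pXn2r _ 2) ?nnegrE ?mulr_ge0//.
  by rewrite exprMn a2 r2 mulrA.
have cab : - (a * b) <= c.
  have : `|c| <= a * b.
    rewrite -(@ler_pXn2r _ 2) ?nnegrE ?mulr_ge0//.
    by rewrite real_normK ?num_real// exprMn a2 b2.
  by rewrite ler_norml => /andP[].
have hc : - (h * (a * b)) <= h * c by rewrite -mulrN ler_wpM2l.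
have hbr : h * b <= h * r by rewrite ler_wpM2l.
(* Because [h * r <= a], the square decreases as [h * b] grows to [h * r]: the worst drift is the
   largest one. *)
have sq : (a - h * r) ^+ 2 <= (a - h * b) ^+ 2.
  by rewrite lerXn2r ?nnegrE ?subr_ge0//; lra.
pose Q := S * r / (2 * A).
have Q0 : 0 <= Q by rewrite divr_ge0 ?mulr_ge0// ltW.
have An0 : A != 0 by rewrite gt_eqF.
have nvE : nv = r ^+ 2 / A by rewrite r2 mulrAC divff// mul1r.
have Q2 : Q ^+ 2 = S ^+ 2 / (4 * A) * nv by rewrite nvE /Q; field.
have hSQ : h * S * nv = 2 * (h * r) * Q by rewrite nvE /Q; field.
have := @shrunk_square_lower_bound a (h * r) Q (M * nv).
rewrite a2 Q2 -hSQ mulr_ge0// hra Q0 => /(_ isT isT isT Mx).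
have -> : M * nv <= S ^+ 2 / (4 * A) * nv by rewrite ler_wpM2r.
move=> /(_ isT) final; apply: (le_trans final).
rewrite lerD2r; apply: (le_trans sq).
rewrite -a2 -b2; nra.
Qed.

(** [1 - 1 / 4 <= expR (- (1 / 4))] gives [expR (1 / 4) <= 4 / 3], whose fifth power is below 5, the
    leading factor of [K1]. *)
Lemma expR_5_4_le5 : expR (5 / 4 : R) <= 5.
Proof.
have e1 : expR (1 / 4 : R) <= 4 / 3.
  have := expR_ge1Dx (- (1 / 4) : R); rewrite expRN => h.
  have e0 := expR_gt0 (1 / 4 : R).
  have : 3 / 4 <= (expR (1 / 4 : R))^-1 by lra.
  by rewrite -ler_pV2 ?invrK ?inE ?unitfE ?gt_eqF ?divr_gt0 ?invr_gt0// invf_div.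
have -> : (5 / 4 : R) = 5%:R * (1 / 4) by field.
rewrite expRM_natl.
apply: (@le_trans _ _ ((4 / 3) ^+ 5)); first by rewrite lerXn2r ?nnegrE ?expR_ge0.
lra.
Qed.

(* With [z = T * sqrt C] and [u = h * sqrt C], the step restriction at time 0
   gives [5 * u ^+ 2 * expR (2 * z ^+ 2) <= 1], so [u * z <= 1 / 4]; the other
   sublinear term is absorbed by [2 * z <= 2 * z ^+ 2 + 1 / 2]. *)
Lemma growth_factor_bound (T C x0 K : R) (N n : nat) :
  0 < T -> 0 < C -> 0 <= x0 -> (0 < N)%N -> (n <= N)%N ->
  K = K1 C T x0 ->
  let h := T / N%:R in
  h ^+ 2 * (C * K) <= x0 ->
  (1 + x0) * (1 + 2 * (h * Num.sqrt C) + 3 * (h ^+ 2 * C) + 2 * (h * C)) ^+ n <= K.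
Proof.
move=> T0 C0 x00 N0 nN KE h hK.
have NR0 : 0 < N%:R :> R by rewrite ltr0n.
have h0 : 0 < h by rewrite divr_gt0.
pose g := Num.sqrt C.
have g0 : 0 < g by rewrite sqrtr_gt0.
have g2 : g ^+ 2 = C by rewrite sqr_sqrtr// ltW.
pose z := T * g; pose u := h * g.
have z0 : 0 < z by rewrite mulr_gt0.
have u0 : 0 < u by rewrite mulr_gt0.
have z2 : z ^+ 2 = C * T ^+ 2 by rewrite exprMn g2 mulrC.
have u2 : u ^+ 2 = h ^+ 2 * C by rewrite exprMn g2.
pose e := expR (C * (2 * T ^+ 2 + 8 * T)).
(* Square [2 * z <= 1 + z ^+ 2 <= expR (z ^+ 2)]; the exponent of [e] is at least [2 * z ^+ 2]. *)
have e_ge : 4 * z ^+ 2 <= e.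
  have e1 : expR (z ^+ 2) ^+ 2 <= e.
    rewrite -expRM_natl ler_expR z2.
    by have := mulr_gt0 C0 T0; nra.
  apply: le_trans e1; have -> : 4 * z ^+ 2 = (2 * z) ^+ 2 by ring.
  have z20 : 0 <= 2 * z by lra.
  rewrite lerXn2r ?nnegrE ?expR_ge0//.
  by have := expR_ge1Dx (z ^+ 2); have := sqr_ge0 (z - 1); nra.
have ue : 5 * u ^+ 2 * e <= 1.
  have : 5 * u ^+ 2 * e * (1 + x0) <= 1 * (1 + x0).
    have -> : 5 * u ^+ 2 * e * (1 + x0) = h ^+ 2 * (C * K).
      by rewrite u2 KE /K1 -/e; ring.
    by rewrite mul1r; lra.
  by rewrite ler_pM2r//; lra.
have uz : u * z <= 1 / 4.
  have uz0 : 0 <= u * z by rewrite ltW// mulr_gt0.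
  rewrite -(@ler_pXn2r _ 2) ?nnegrE ?divr_ge0//.
  have : 5 * u ^+ 2 * (4 * z ^+ 2) <= 1.
    apply: le_trans ue; apply: ler_wpM2l => //.
    by have := sqr_ge0 u; lra.
  rewrite exprMn; have := mulr_ge0 (sqr_ge0 u) (sqr_ge0 z); nra.
pose D := 2 * u + 3 * (h ^+ 2 * C) + 2 * (h * C).
have hC : 0 < h * C by rewrite mulr_gt0.
have D0 : 0 <= D by rewrite /D -u2; have := sqr_ge0 u; lra.
have -> : 1 + 2 * (h * Num.sqrt C) + 3 * (h ^+ 2 * C) + 2 * (h * C) = 1 + D.
  by rewrite /D /u /g; ring.
have Dn : (1 + D) ^+ n <= expR (N%:R * D).
  apply: (@le_trans _ _ ((1 + D) ^+ N)); first by rewrite ler_weXn2l// lerDl.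
  have D1 : 0 <= 1 + D by lra.
  rewrite expRM_natl lerXn2r ?nnegrE ?expR_ge0//.
  exact: expR_ge1Dx.
(* The [5 / 4] is [3 / 4] from [3 * (u * z)] plus [1 / 2] from [2 * z]; the term [2 * (C * T)] fits
   into [8 * (C * T)]. *)
have ND : N%:R * D <= C * (2 * T ^+ 2 + 8 * T) + 5 / 4.
  have Nh : N%:R * h = T by rewrite /h mulrCA divff ?mulr1// gt_eqF.
  have -> : N%:R * D = 2 * z + 3 * (u * z) + 2 * (C * T).
    rewrite /D -u2.
    have -> : N%:R * (2 * u + 3 * u ^+ 2 + 2 * (h * C)) =
      2 * (N%:R * h * g) + 3 * (u * (N%:R * h * g)) + 2 * (C * (N%:R * h)).
      by rewrite /u; ring.
    by rewrite Nh.
  rewrite mulrDr (_ : C * (2 * T ^+ 2) = 2 * z ^+ 2); last by rewrite z2; ring.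
  by have := mulr_gt0 C0 T0; have := sqr_ge0 (2 * z - 1); nra.
have e0 : 0 <= e by exact: expR_ge0.
have : (1 + D) ^+ n <= 5 * e.
  apply: (le_trans Dn); apply: (@le_trans _ _ (e * expR (5 / 4))).
    by rewrite -expRD ler_expR.
  by rewrite mulrC ler_wpM2r// expR_5_4_le5.
rewrite KE /K1 -/e => Dne.
have -> : 5 * (1 + x0) * e = (1 + x0) * (5 * e) by ring.
by rewrite ler_wpM2l//; lra.
Qed.

(** [Num.sqrt] is 0 on negative numbers, so a positive step below the bound already forces
    [0 < s]. *)
Lemma step_restriction_sqr (s C K h : R) : 0 < h -> 0 < C -> 0 < K ->
  h <= Num.sqrt s / (Num.sqrt C * Num.sqrt K) ->
  0 < s /\ h ^+ 2 * (C * K) <= s.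
Proof.
move=> h0 C0 K0.
have CK : 0 < Num.sqrt C * Num.sqrt K by rewrite mulr_gt0 ?sqrtr_gt0.
rewrite ler_pdivlMr// => hs.
have ss : 0 < Num.sqrt s by apply: lt_le_trans hs; rewrite mulr_gt0.
have s0 : 0 < s by rewrite -sqrtr_gt0.
split => //; rewrite -[leRHS](@sqr_sqrtr _ s) ?(ltW s0)//.
have -> : h ^+ 2 * (C * K) = (h * (Num.sqrt C * Num.sqrt K)) ^+ 2.
  by rewrite !exprMn !sqr_sqrtr ?(ltW C0) ?(ltW K0).
by rewrite lerXn2r ?nnegrE ?(ltW ss)// mulr_ge0 ?(ltW h0) ?(ltW CK).
Qed.

(** [x], [UA], [QA], [B] are the mean squares of the state, the two orthogonal parts of the drift
    coefficient, and the noise coefficient. The cross term gives [2 * (h * g)]; the second-order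
    terms total [3 * UA + 2 * QA], hence the 3; the noise, seen through both [U] and [V], gives
    [2 * (h * C)]. *)
Lemma euler_step_upper_bound (h g C x UA QA B D VD VY VUA NB : R) :
  0 < h -> 0 < g -> g * g = C -> 0 <= x -> 0 <= UA -> 0 <= QA -> 0 <= B ->
  UA + QA + B <= C * (1 + x) -> VY <= h ^+ 2 * QA -> VUA <= UA ->
  VD <= 2 * VY + 2 * h ^+ 2 * VUA ->
  D <= x + h * (g * x + g^-1 * UA) + h ^+ 2 * UA -> NB <= 2 * B ->
  1 + (D + VD + h * NB) <=
  (1 + x) * (1 + 2 * (h * g) + 3 * (h ^+ 2 * C) + 2 * (h * C)).
Proof.
move=> h0 g0 g2 x0 UA0 QA0 B0 gr VYle VUAle VDle Dle NBle.
have h2 : 0 < h ^+ 2 by rewrite exprn_gt0.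
have UAg : g^-1 * UA <= g * (1 + x).
  by rewrite mulrC ler_pdivrMr// mulrAC g2; lra.
have b1 : h * (g^-1 * UA) <= h * (g * (1 + x)) by rewrite ler_pM2l.
have b2 : h * NB <= h * (2 * B) by rewrite ler_pM2l.
have b3 : h ^+ 2 * VUA <= h ^+ 2 * UA by rewrite ler_pM2l.
have b4 : h ^+ 2 * (3 * (UA + QA)) <= h ^+ 2 * (3 * (C * (1 + x))).
  by rewrite ler_pM2l//; lra.
have b5 : h * B <= h * (C * (1 + x)) by rewrite ler_pM2l//; lra.
have hg : 0 <= h * g by rewrite ltW// mulr_gt0.
have b6 : 0 <= h ^+ 2 * QA by rewrite mulr_ge0// ltW.
lra.
Qed.

End ScalarEstimates.

(** * Mean squares of random matrices *)

Section MeanSquare.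
Context {R : realType} {dO : measure_display} {Omega : measurableType dO}.
Variable P : probability Omega R.

Definition sqint_mx p q (Z : Omega -> 'M[R]_(p, q)) :=
  forall i j, sqint P (fun w => Z w i j).

Definition mean_square p q (Z : Omega -> 'M[R]_(p, q)) : R :=
  \int[P]_w fnorm (Z w) ^+ 2.

Lemma integrable_fnorm p q (Z : Omega -> 'M[R]_(p, q)) : sqint_mx Z ->
  P.-integrable setT (EFin \o (fun w => fnorm (Z w) ^+ 2)).
Proof.
move=> sZ.
apply: (@eq_integrable _ _ _ _ _ measurableT
  (fun w => \sum_i (\sum_j (Z w i j ^+ 2)%:E))%E).
  by move=> w _; rewrite /= fnormE -sumEFin; apply: eq_bigr => i _; rewrite sumEFin.
apply: integrable_sum => // i _; apply: integrable_sum => // j _.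
by case: (sZ i j).
Qed.

Lemma mean_squareE p q (Z : Omega -> 'M[R]_(p, q)) : sqint_mx Z ->
  mean_square Z = \sum_i \sum_j l2dot P (fun w => Z w i j) (fun w => Z w i j).
Proof.
move=> sZ; rewrite /mean_square.
have EE i j : (\int[P]_w (Z w i j ^+ 2)%:E =
    (l2dot P (fun w => Z w i j) (fun w => Z w i j))%:E)%E.
  rewrite /l2dot /Rintegral fineK//.
  apply: integrable_fin_num => //.
  by case: (sZ i j).
rewrite /Rintegral.
under eq_integral => w _.
  rewrite fnormE -sumEFin; under eq_bigr do rewrite -sumEFin; over.
rewrite integral_sum//; last first.
  by move=> i; apply: integrable_sum => // j _; case: (sZ i j).
under eq_bigr => i _.
  rewrite integral_sum//; last by move=> j; case: (sZ i j).
  under eq_bigr do rewrite EE; rewrite sumEFin; over.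
by rewrite sumEFin.
Qed.

Lemma mean_square_cvE p (Z : Omega -> 'cV[R]_p) : sqint_mx Z ->
  mean_square Z = \sum_i l2dot P (fun w => Z w i 0) (fun w => Z w i 0).
Proof.
by move=> sZ; rewrite mean_squareE//; apply: eq_bigr => i _; rewrite big_ord1.
Qed.

Lemma mean_square_ge0 p q (Z : Omega -> 'M[R]_(p, q)) : 0 <= mean_square Z.
Proof. by apply: Rintegral_ge0 => w _; exact: sqr_ge0. Qed.

Lemma eq_mean_square p q r s (Z : Omega -> 'M[R]_(p, q)) (Z' : Omega -> 'M[R]_(r, s)) :
  (forall w, fnorm (Z w) ^+ 2 = fnorm (Z' w) ^+ 2) -> mean_square Z = mean_square Z'.
Proof. by move=> h; apply: eq_Rintegral => w _; exact: h. Qed.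

Lemma le_mean_square c p q r s (Z : Omega -> 'M[R]_(p, q))
    (Z' : Omega -> 'M[R]_(r, s)) : sqint_mx Z -> sqint_mx Z' ->
  (forall w, fnorm (Z w) ^+ 2 <= c * fnorm (Z' w) ^+ 2) ->
  mean_square Z <= c * mean_square Z'.
Proof.
move=> sZ sZ' h; rewrite /mean_square -RintegralZl//; last exact: integrable_fnorm.
apply: le_Rintegral => //; first exact: integrable_fnorm.
exact: (integrableZl measurableT c (integrable_fnorm sZ')).
Qed.

Lemma mean_square_add p q r s u v (Z : Omega -> 'M[R]_(p, q))
    (Z1 : Omega -> 'M[R]_(r, s)) (Z2 : Omega -> 'M[R]_(u, v)) :
  sqint_mx Z1 -> sqint_mx Z2 ->
  (forall w, fnorm (Z w) ^+ 2 = fnorm (Z1 w) ^+ 2 + fnorm (Z2 w) ^+ 2) ->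
  mean_square Z = mean_square Z1 + mean_square Z2.
Proof.
move=> s1 s2 h; rewrite /mean_square -RintegralD//; [|exact: integrable_fnorm..].
by apply: eq_Rintegral => w _; exact: h.
Qed.

Lemma sqint_mxMl p q r (L : 'M[R]_(p, q)) (Z : Omega -> 'M[R]_(q, r)) :
  sqint_mx Z -> sqint_mx (fun w => L *m Z w).
Proof.
move=> sZ i j; under [X in sqint _ X]eq_fun do rewrite mxE.
by apply: sqint_sum => l; exact: sqintZ.
Qed.

Lemma sqint_mxD p q (Z Z' : Omega -> 'M[R]_(p, q)) :
  sqint_mx Z -> sqint_mx Z' -> sqint_mx (fun w => Z w + Z' w).
Proof.
by move=> s1 s2 i j; under [X in sqint _ X]eq_fun do rewrite mxE; exact: sqintD.
Qed.

Lemma sqint_mxZ c p q (Z : Omega -> 'M[R]_(p, q)) :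
  sqint_mx Z -> sqint_mx (fun w => c *: Z w).
Proof.
by move=> s1 i j; under [X in sqint _ X]eq_fun do rewrite mxE; exact: sqintZ.
Qed.

(** Links inner products of coordinates to the moment matrices in which the equation for the basis
    is written. *)
Lemma l2dot_mulmx p q p' q' (L : 'M[R]_(p, q)) (L' : 'M[R]_(p', q'))
    (Z : Omega -> 'cV[R]_q) (Z' : Omega -> 'cV[R]_q') i j :
  sqint_mx Z -> sqint_mx Z' ->
  l2dot P (fun w => (L *m Z w) i 0) (fun w => (L' *m Z' w) j 0) =
  (L *m Emx P (fun w => Z w *m (Z' w)^T) *m L'^T) i j.
Proof.
move=> sZ sZ'.
have EE a b : Emx P (fun w => Z w *m (Z' w)^T) a b =
    l2dot P (fun w => Z w a 0) (fun w => Z' w b 0).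
  rewrite mxE unlock /l2dot /Rintegral; congr fine; apply: eq_integral => w _.
  by rewrite mxE big_ord1 mxE.
rewrite (eq_l2dot P (f' := fun w => \sum_a L i a * Z w a 0)
  (g' := fun w => \sum_b L' j b * Z' w b 0)); last 2 first.
  by move=> w; rewrite mxE.
  by move=> w; rewrite mxE.
rewrite l2dot_sumr; last 2 first.
- by move=> b; exact: sqintZ.
- by apply: sqint_sum => a; exact: sqintZ.
rewrite mxE; apply: eq_bigr => b _.
rewrite l2dotZr//; last by apply: sqint_sum => a; exact: sqintZ.
rewrite l2dot_suml//; last by move=> a; exact: sqintZ.
rewrite !mxE mulrC; congr (_ * _); apply: eq_bigr => a _.
by rewrite l2dotZl// EE.
Qed.

Lemma second_moment_sym k (Y : Omega -> 'cV[R]_k) :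
  (second_moment P Y)^T = second_moment P Y.
Proof.
apply/matrixP => i j; rewrite !mxE; congr (fine _); rewrite unlock.
by apply: eq_integral => w _; rewrite !mxE !big_ord1 !mxE mulrC.
Qed.

Lemma second_moment_form k (Y : Omega -> 'cV[R]_k) (v : 'cV[R]_k) :
  sqint_mx Y ->
  (v^T *m second_moment P Y *m v) 0 0 = mean_square (fun w => v^T *m Y w).
Proof.
move=> sY; rewrite mean_square_cvE; last exact: sqint_mxMl.
by rewrite big_ord1 l2dot_mulmx// trmxK.
Qed.

End MeanSquare.

(** * One step of the scheme with abstract noise *)

Section OneStep.
Context {R : realType} {dO : measure_display} {Omega : measurableType dO}.
Variables (P : probability Omega R) (G : (Omega -> R) -> Prop).
Hypothesis GM : forall f g, G f -> G g -> G (fun w => f w * g w).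
Hypothesis GD : forall f g, G f -> G g -> G (fun w => f w + g w).
Hypothesis Gcst : forall c, G (fun=> c).
Variables (k d m : nat) (h C : R) (xi : 'I_m -> Omega -> R).
Hypotheses (h_gt0 : 0 < h) (C_gt0 : 0 < C).
Hypothesis noise : white_noise P G h xi.
Variables (U : 'M[R]_(k, d)) (Y : Omega -> 'cV[R]_k).
Variables (A : Omega -> 'cV[R]_d) (B : Omega -> 'M[R]_(d, m)).
Hypothesis UU : U *m U^T = 1%:M.
Hypotheses (sY : sqint_mx P Y) (sA : sqint_mx P A) (sB : sqint_mx P B).
Hypothesis GY : forall i j, G (fun w => Y w i j).
Hypothesis GA : forall i j, G (fun w => A w i j).
Hypothesis GB : forall i j, G (fun w => B w i j).
Hypothesis growth : forall w,
  fnorm (A w) ^+ 2 + fnorm (B w) ^+ 2 <= C * (1 + fnorm (Y w) ^+ 2).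

Let drift w := Y w + h *: (U *m A w).

Let Yt w := drift w + U *m B w *m \col_j xi j w.

Let G_sum I (r : seq I) (f : I -> Omega -> R) :
  (forall i, G (f i)) -> G (fun w => \sum_(i <- r) f i w).
Proof.
move=> Gf; elim: r => [|i r ih].
  by under [X in G X]eq_fun do rewrite big_nil; exact: Gcst.
by under [X in G X]eq_fun do rewrite big_cons; exact: GD.
Qed.

Let G_mxMl p q r (L : 'M[R]_(p, q)) (Z : Omega -> 'M[R]_(q, r)) :
  (forall i j, G (fun w => Z w i j)) -> forall i j, G (fun w => (L *m Z w) i j).
Proof.
move=> GZ i j; under [X in G X]eq_fun do rewrite mxE.
by apply: G_sum => l; apply: GM.
Qed.

Let G_drift i j : G (fun w => drift w i j).
Proof.
under [X in G X]eq_fun do rewrite mxE.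
apply: GD => //; under [X in G X]eq_fun do rewrite mxE.
by apply: GM => //; exact: G_mxMl.
Qed.

Let sUA : sqint_mx P (fun w => U *m A w).
Proof. exact: sqint_mxMl. Qed.

Let sdrift : sqint_mx P drift.
Proof. by apply: sqint_mxD => //; exact: sqint_mxZ. Qed.

Let step_coord p (L : 'M[R]_(p, k)) i w : (L *m Yt w) i 0 =
  (L *m drift w) i 0 + \sum_j (L *m U *m B w) i j * xi j w.
Proof.
rewrite mulmxDr mxE; congr (_ + _); rewrite !mulmxA mxE.
by apply: eq_bigr => j _; rewrite [X in _ * X]mxE.
Qed.

Let noise_coord p (L : 'M[R]_(p, k)) i :
  sqint P (fun w => (L *m Yt w) i 0) /\
  l2dot P (fun w => (L *m Yt w) i 0) (fun w => (L *m Yt w) i 0) =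
  l2dot P (fun w => (L *m drift w) i 0) (fun w => (L *m drift w) i 0) +
  h * \sum_j l2dot P (fun w => (L *m U *m B w) i j) (fun w => (L *m U *m B w) i j).
Proof.
rewrite (_ : (fun w => (L *m Yt w) i 0) = fun w => (L *m drift w) i 0 +
  \sum_j (L *m U *m B w) i j * xi j w); last first.
  by apply/funext => w; exact: step_coord.
apply: (noise_l2dot GM noise).
- exact: G_mxMl.
- exact: sqint_mxMl.
- by move=> j; exact: G_mxMl.
- by move=> j; exact: sqint_mxMl.
Qed.

Lemma sqint_mx_step : sqint_mx P Yt.
Proof.
move=> i j; rewrite ord1; have [+ _] := noise_coord 1%:M i.
by under eq_fun do rewrite mul1mx.
Qed.

(** The left factor is arbitrary because the lower bound takes [L = v^T] and the upper bound
    [L = (U + V)^T]. *)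
Lemma mean_square_step p (L : 'M[R]_(p, k)) :
  mean_square P (fun w => L *m Yt w) =
  mean_square P (fun w => L *m drift w) +
  h * mean_square P (fun w => L *m U *m B w).
Proof.
rewrite !mean_square_cvE; try exact: sqint_mxMl; last first.
  by apply: sqint_mxMl; exact: sqint_mx_step.
rewrite mean_squareE; last exact: sqint_mxMl.
rewrite mulr_sumr -big_split; apply: eq_bigr => i _ /=.
by have [_ ->] := noise_coord L i.
Qed.

Let mean_square_growth :
  mean_square P A + mean_square P B <= C * (1 + mean_square P Y).
Proof.
have iY := integrable_fnorm sY.
have c1 : P.-integrable setT (EFin \o (fun _ : Omega => 1 : R)).
  exact: finite_measure_integrable_cst.
have i1Y : P.-integrable setT (EFin \o (fun w => 1 + fnorm (Y w) ^+ 2)).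
  exact: (integrableD measurableT c1 iY).
have -> : 1 + mean_square P Y = \int[P]_w (1 + fnorm (Y w) ^+ 2).
  by rewrite RintegralD// Rintegral_cst//= probability_setT mulr1.
rewrite -RintegralZl// -RintegralD//; try exact: integrable_fnorm.
apply: le_Rintegral => //.
- exact: (integrableD measurableT (integrable_fnorm sA) (integrable_fnorm sB)).
- exact: (integrableZl measurableT C i1Y).
Qed.

(** The two lower bounds on the form at [v] differ in role: [s] brings in the step restriction, [M]
    is the one propagated. *)
Lemma step_lower_bound (K S M s : R) (v : 'cV[R]_k) :
  1 + mean_square P Y <= K -> 0 <= S ->
  (forall w, loewner_ge (B w *m (B w)^T) S%:M) ->
  s * fnorm v ^+ 2 <= mean_square P (fun w => v^T *m Y w) ->
  h ^+ 2 * (C * K) <= s ->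
  M * fnorm v ^+ 2 <= mean_square P (fun w => v^T *m Y w) ->
  M <= S ^+ 2 / (4 * (C * K)) ->
  M * fnorm v ^+ 2 <= mean_square P (fun w => v^T *m Yt w).
Proof.
move=> YK S0 BS sv hs Mv MS.
have Y0 := mean_square_ge0 P Y.
have svY := sqint_mxMl v^T sY; have svUA := sqint_mxMl v^T sUA.
pose y w := (v^T *m Y w) 0 0; pose a w := (v^T *m (U *m A w)) 0 0.
have sy : sqint P y by exact: svY.
have sa : sqint P a by exact: svUA.
rewrite mean_square_step.
have -> : mean_square P (fun w => v^T *m drift w) =
    l2dot P y y + 2 * h * l2dot P y a + h ^+ 2 * l2dot P a a.
  rewrite mean_square_cvE; last exact: sqint_mxMl.
  rewrite big_ord1 (eq_l2dot P (f' := fun w => y w + h * a w)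
    (g' := fun w => y w + h * a w)).
  - exact: l2dot_sqrDZ.
  - by move=> w; rewrite mulmxDr -scalemxAr mxE [X in _ + X]mxE.
  - by move=> w; rewrite mulmxDr -scalemxAr mxE [X in _ + X]mxE.
have yE : mean_square P (fun w => v^T *m Y w) = l2dot P y y.
  by rewrite mean_square_cvE// big_ord1.
have aE : mean_square P (fun w => v^T *m (U *m A w)) = l2dot P a a.
  by rewrite mean_square_cvE// big_ord1.
rewrite yE in sv Mv.
have vU : fnorm (v^T *m U) ^+ 2 = fnorm v ^+ 2.
  by rewrite -fnorm_tr trmx_mul trmxK fnorm_isometry.
have aK : l2dot P a a <= C * K * fnorm v ^+ 2.
  rewrite -aE; apply: (@le_trans _ _ (fnorm v ^+ 2 * mean_square P A)).
    apply: le_mean_square => // w; rewrite mulmxA -vU.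
    exact: fnorm_mul_le.
  rewrite mulrC ler_wpM2r ?sqr_ge0//.
  apply: (@le_trans _ _ (C * (1 + mean_square P Y))); last by rewrite ler_pM2l.
  by apply: le_trans mean_square_growth; rewrite lerDl mean_square_ge0.
(* The Loewner bound is tested at [U^T *m v], which has the norm of [v] because the rows of [U] are
   orthonormal. *)
have bS : S * fnorm v ^+ 2 <= mean_square P (fun w => v^T *m U *m B w).
  have -> : S * fnorm v ^+ 2 = \int[P]_w (S * fnorm v ^+ 2).
    by rewrite Rintegral_cst//= probability_setT mulr1.
  apply: le_Rintegral => //.
  - exact: finite_measure_integrable_cst.
  - by apply: integrable_fnorm; exact: sqint_mxMl.
  move=> w _; have [_ /(_ (v^T *m U)^T)] := BS w.
  rewrite quadratic_form_sub subr_ge0 fnorm_tr vU => /le_trans; apply.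
  rewrite trmxK -fnorm_tr fnorm_trace trmxK !trmx_mul trmxK.
  by rewrite /mxtrace big_ord1 !mulmxA.
have CK : 0 < C * K.
  by rewrite mulr_gt0// (lt_le_trans ltr01)// (le_trans _ YK)// lerDl.
have n0 := sqr_ge0 (fnorm v).
have y0 := l2dot_ge0 P y; have a0 := l2dot_ge0 P a.
apply: (@le_trans _ _ (l2dot P y y + 2 * h * l2dot P y a + h ^+ 2 * l2dot P a a +
  h * S * fnorm v ^+ 2)); last first.
  by rewrite lerD2l -mulrA ler_pM2l.
apply: (@euler_step_lower_bound _ _ _ _ _ (C * K)) => //; first exact: ltW.
- exact: l2dot_cauchy_schwarz.
- by apply: le_trans sv; rewrite ler_wpM2r.
Qed.

Variables (V : 'M[R]_(k, d)) (s : R).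
Hypothesis s_gt0 : 0 < s.
Hypothesis sCv : forall v : 'cV[R]_k,
  s * fnorm v ^+ 2 <= (v^T *m second_moment P Y *m v) 0 0.
Hypothesis V_eq : second_moment P Y *m V =
  h *: (Emx P (fun w => Y w *m (A w)^T) *m (1%:M - U^T *m U)).

Let Q : 'M[R]_d := 1%:M - U^T *m U.

(** [1 - U^T *m U] annihilates [U^T], and the lower bound on the form makes the moment matrix
    invertible. *)
Lemma basis_increment_orthogonal : V *m U^T = 0.
Proof.
have Cu : second_moment P Y \in unitmx.
  apply: trivial_kernel_unitmx => v Cv0; apply: fnorm_eq0.
  have := sCv v; rewrite -mulmxA Cv0 mulmx0 mxE pmulr_rle0// => v0.
  by apply/eqP; rewrite eq_le v0 sqr_ge0.
rewrite -[LHS](mulKmx Cu) [second_moment P Y *m _]mulmxA V_eq.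
rewrite -scalemxAl -mulmxA mulmxBl mul1mx.
by rewrite -mulmxA UU mulmx1 subrr mulmx0 scaler0 mulmx0.
Qed.

Let sVY : sqint_mx P (fun w => V^T *m Y w).
Proof. exact: sqint_mxMl. Qed.

Let sQA : sqint_mx P (fun w => Q *m A w).
Proof. exact: sqint_mxMl. Qed.

(* [V^T *m Y] is [h] times the L^2-projection of [Q *m A] on the span of [Y]. *)
Lemma mean_square_basis_increment :
  mean_square P (fun w => V^T *m Y w) <= h ^+ 2 * mean_square P (fun w => Q *m A w).
Proof.
rewrite !mean_square_cvE// mulr_sumr; apply: ler_sum => i _.
have QT : Q^T = Q by rewrite /Q linearB/= trmx1 trmx_mul trmxK.
(* The normal equation of the projection, a diagonal entry of [V^T *m V_eq]. Young's inequality then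
   bounds twice this quantity by itself plus the term in [h ^+ 2]. *)
have E : l2dot P (fun w => (V^T *m Y w) i 0) (fun w => (V^T *m Y w) i 0) =
    h * l2dot P (fun w => (V^T *m Y w) i 0) (fun w => (Q *m A w) i 0).
  rewrite !l2dot_mulmx// trmxK QT -mulmxA -[Emx P _]/(second_moment P Y) V_eq -/Q.
  by rewrite -scalemxAr mulmxA mxE.
have := l2dot_young h (sVY i 0) (sQA i 0); rewrite -mulrA -E.
by rewrite mulr_natl mulr2n lerD2l.
Qed.

(** The form bound is summed over the columns of [V]: the diagonal of [V^T C_Y V] holds the mean
    squares of the coordinates of [V^T *m Y]. *)
Lemma fnorm_basis_increment :
  s * fnorm V ^+ 2 <= mean_square P (fun w => V^T *m Y w).
Proof.
rewrite fnorm_sum_col mulr_sumr mean_square_cvE//; apply: ler_sum => i _.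
apply: (le_trans (sCv (col i V))); rewrite l2dot_mulmx// trmxK.
rewrite -[Emx P _]/(second_moment P Y) le_eqVlt; apply/orP; left; apply/eqP.
rewrite tr_col -row_mul !mxE; apply: eq_bigr => j _.
by rewrite !mxE.
Qed.

Let pythagoras :
  mean_square P A = mean_square P (fun w => U *m A w) + mean_square P (fun w => Q *m A w).
Proof.
apply: mean_square_add => // w; rewrite -(fnorm_pythagoras (A w) UU).
by rewrite /Q mulmxBl mul1mx mulmxA.
Qed.

Lemma step_upper_bound (K : R) :
  1 + mean_square P Y <= K -> h ^+ 2 * (C * K) <= s ->
  1 + mean_square P (fun w => (U + V)^T *m Yt w) <=
  (1 + mean_square P Y) *
  (1 + 2 * (h * Num.sqrt C) + 3 * (h ^+ 2 * C) + 2 * (h * C)).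
Proof.
move=> YK hs.
have VU := basis_increment_orthogonal.
have VY := mean_square_basis_increment.
have AC : mean_square P A <= C * (1 + mean_square P Y).
  by apply: le_trans mean_square_growth; rewrite lerDl mean_square_ge0.
(* [s * |V| ^+ 2 <= E |V^T Y| ^+ 2 <= h ^+ 2 * E |A| ^+ 2 <= h ^+ 2 * (C * K) <= s]. *)
have V1 : fnorm V ^+ 2 <= 1.
  rewrite -(ler_pM2l s_gt0) mulr1; apply: (le_trans fnorm_basis_increment).
  apply: (le_trans VY); apply: le_trans hs; rewrite ler_pM2l ?exprn_gt0//.
  apply: (@le_trans _ _ (mean_square P A)).
    by rewrite pythagoras lerDr mean_square_ge0.
  by apply: (le_trans AC); rewrite ler_pM2l.
have Vle q (Z : 'M[R]_(k, q)) : fnorm (V^T *m Z) ^+ 2 <= 1 * fnorm Z ^+ 2.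
  apply: (le_trans (fnorm_mul_le _ _)); rewrite fnorm_tr.
  by rewrite ler_wpM2r// sqr_ge0.
(* The factor 2 is [1 + 1]: the noise enters once through [U] and once through [V], which does not
   expand norms. *)
have noiseB : mean_square P (fun w => (U + V)^T *m U *m B w) <= 2 * mean_square P B.
  apply: le_mean_square => // [|w]; first exact: sqint_mxMl.
  rewrite -mulmxA fnorm_orthogonal_add// mulr_natl mulr2n.
  have UB : fnorm (U *m B w) ^+ 2 <= fnorm (B w) ^+ 2.
    by rewrite -(fnorm_pythagoras (B w) UU) lerDl sqr_ge0.
  by apply: lerD => //; apply: (le_trans (Vle _ _)); rewrite mul1r.
have sVd : sqint_mx P (fun w => V^T *m drift w) by exact: sqint_mxMl.
have sVUA : sqint_mx P (fun w => V^T *m (U *m A w)) by exact: sqint_mxMl.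
have VUA : mean_square P (fun w => V^T *m (U *m A w)) <=
    mean_square P (fun w => U *m A w).
  by rewrite -[leRHS]mul1r; apply: le_mean_square.
have driftV : mean_square P (fun w => V^T *m drift w) <=
    2 * mean_square P (fun w => V^T *m Y w) +
    2 * h ^+ 2 * mean_square P (fun w => V^T *m (U *m A w)).
  rewrite !mean_square_cvE// !mulr_sumr -big_split/=; apply: ler_sum => i _.
  rewrite (eq_l2dot P
    (f' := fun w => (V^T *m Y w) i 0 + h * (V^T *m (U *m A w)) i 0)
    (g' := fun w => (V^T *m Y w) i 0 + h * (V^T *m (U *m A w)) i 0)).
  - exact: (l2dot_sqrDZ_le2 h (sVY i 0) (sVUA i 0)).
  - by move=> w; rewrite mulmxDr -scalemxAr mxE [X in _ + X]mxE.
  - by move=> w; rewrite mulmxDr -scalemxAr mxE [X in _ + X]mxE.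
(* With this weight both halves of the cross term carry [h * Num.sqrt C], as [E |U A| ^+ 2] is at
   most [C * (1 + E |Y| ^+ 2)]. *)
pose g := Num.sqrt C.
have g0 : 0 < g by rewrite sqrtr_gt0.
have g2 : g * g = C by rewrite -expr2 sqr_sqrtr// ltW.
have driftU : mean_square P drift <= mean_square P Y +
    h * (g * mean_square P Y + g^-1 * mean_square P (fun w => U *m A w)) +
    h ^+ 2 * mean_square P (fun w => U *m A w).
  rewrite !mean_square_cvE// !mulr_sumr -big_split/= mulr_sumr -!big_split/=.
  apply: ler_sum => i _.
  rewrite (eq_l2dot P
    (f' := fun w => Y w i 0 + h * (U *m A w) i 0)
    (g' := fun w => Y w i 0 + h * (U *m A w) i 0)).
  - exact: (l2dot_sqrDZ_weighted h_gt0 g0 (sY i 0) (sUA i 0)).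
  - by move=> w; rewrite mxE [X in _ + X]mxE.
  - by move=> w; rewrite mxE [X in _ + X]mxE.
rewrite mean_square_step (mean_square_add (Z := fun w => (U + V)^T *m drift w)
  (Z1 := drift) (Z2 := fun w => V^T *m drift w))//; last first.
  by move=> w; rewrite fnorm_orthogonal_add.
apply: (euler_step_upper_bound h_gt0 g0 g2 _ _ _ _ _ VY VUA driftV driftU noiseB);
  try exact: mean_square_ge0.
by rewrite -pythagoras; exact: mean_square_growth.
Qed.

End OneStep.

(** * Integrability of the data and induction over the time steps *)

Lemma square_integrable_sqint_mx (R : realType) (dO : measure_display)
    (Omega : measurableType dO) (P : probability Omega R) k
    (Y : Omega -> 'cV[R]_k) :
  sigma_algebra setT (@measurable _ Omega) -> square_integrable P Y -> sqint_mx P Y.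
Proof.
move=> sM [mY Y2] i j; rewrite ord1.
have mc l : measurable_fun setT (fun w => Y w l 0).
  apply: (measurable_rv_measurable sM) => //.
  exact: ((measurable_wrtP _ sM).1 mY).
apply: (@sqint_dominated _ _ _ _ _ (fun w => fnorm (Y w) ^+ 2)) => //.
  apply/integrableP; split.
    apply/measurable_EFinP; under eq_fun do rewrite fnorm_cvE.
    by apply: measurable_sum => l; exact: measurable_funX.
  under eq_integral do rewrite gee0_abs ?lee_fin ?sqr_ge0//.
  by move: Y2; rewrite unlock.
move=> w; rewrite fnorm_cvE (bigD1 i)//= lerDl.
by apply: sumr_ge0 => l _; exact: sqr_ge0.
Qed.

Lemma sqint_mx_linear_growth (R : realType) (dO : measure_display)
    (Omega : measurableType dO) (P : probability Omega R) C p q r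
    (Z : Omega -> 'M[R]_(p, q)) (Y : Omega -> 'cV[R]_r) :
  (forall i j, measurable_fun setT (fun w => Z w i j)) -> sqint_mx P Y ->
  (forall w, fnorm (Z w) ^+ 2 <= C * (1 + fnorm (Y w) ^+ 2)) -> sqint_mx P Z.
Proof.
move=> mZ sY ZY i j.
apply: (@sqint_dominated _ _ _ _ _ (fun w => C * (1 + fnorm (Y w) ^+ 2))) => //.
  have c1 : P.-integrable setT (EFin \o (fun _ : Omega => 1 : R)).
    exact: finite_measure_integrable_cst.
  have i1Y : P.-integrable setT (EFin \o (fun w => 1 + fnorm (Y w) ^+ 2)).
    exact: (integrableD measurableT c1 (integrable_fnorm sY)).
  exact: (integrableZl measurableT C i1Y).
move=> w; apply: le_trans (ZY w); rewrite fnormE (bigD1 i)//= (bigD1 j)//= -addrA.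
rewrite lerDl addr_ge0 ?sumr_ge0// => l _; first exact: sqr_ge0.
by apply: sumr_ge0 => l' _; exact: sqr_ge0.
Qed.

Theorem proposition4p4 (R : realType) (dO : measure_display)
    (Omega : measurableType dO) (P : probability Omega R)
    (F : R -> set (set Omega)) (hF : usual_filtration P F)
    (k d m : nat) (hk : (1 <= k)%N) (hkd : (k <= d)%N)
    (W : R -> Omega -> 'cV[R]_m) (hW : brownian_motion P F W)
    (T : R) (hT : 0 < T) (N : nat) (hN : (0 < N)%N)
    (a : R -> 'cV[R]_d -> 'cV[R]_d) (b : R -> 'cV[R]_d -> 'M[R]_(d, m))
    (ha : borel_coefficient a) (hb : borel_coefficient b)
    (U : nat -> 'M[R]_(k, d)) (Y : nat -> Omega -> 'cV[R]_k)
    (Ut : nat -> 'M[R]_(k, d)) (Yt : nat -> Omega -> 'cV[R]_k)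
    (Rq : nat -> 'M[R]_k)
    (hDLR : dlr_euler_maruyama P F W a b N (fun n => n%:R * (T / N%:R))
              U Y Ut Yt Rq)
    (Clgb sigmaB : R) (sigma : nat -> R) (K : R)
    (hClgb : 0 < Clgb)
    (hlgb : forall (s : R) (x : 'cV[R]_d), 0 <= s ->
       fnorm (a s x) ^+ 2 + fnorm (b s x) ^+ 2 <= Clgb * (1 + fnorm x ^+ 2))
    (hsigma : forall n, (n <= N)%N ->
       smallest_eigenvalue (second_moment P (Y n)) (sigma n))
    (hsigma0 : 0 < sigma 0%N)
    (hsigmaB : 0 < sigmaB)
    (hbb : forall (t : R) (x : 'cV[R]_d), 0 <= t ->
       loewner_ge (b t x *m (b t x)^T) (sigmaB%:M))
    (hK : K = K1 Clgb T
                (fine 'E_P[fun w => fnorm ((U 0%N)^T *m Y 0%N w) ^+ 2]))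
    (hdt : forall n, (n <= N)%N ->
       T / N%:R <= Num.sqrt (sigma n) / (Num.sqrt Clgb * Num.sqrt K)) :
  forall n, (n < N)%N ->
    loewner_ge (second_moment P (Y n.+1))
      ((Num.min (sigma 0%N) (sigmaB ^+ 2 / (4 * Clgb * (1 + K))))%:M).
Proof.
pose h := T / N%:R.
have NR0 : 0 < N%:R :> R by rewrite ltr0n.
have h0 : 0 < h by rewrite divr_gt0.
pose t n : R := n%:R * h.
have t_ge0 n : 0 <= t n by rewrite mulr_ge0// ltW.
have tS n : t n.+1 - t n = h by rewrite /t -natr1; ring.
have tlt n : t n < t n.+1 by rewrite -subr_gt0 tS.
have sgF n : sigma_algebra setT (F (t n)) by exact: uf_sigma_algebra hF _ (t_ge0 n).
have sM : sigma_algebra setT (@measurable _ Omega).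
  split=> [//|A mA|A mA]; first by rewrite setTD; exact: measurableC.
  exact: bigcupT_measurable.
have Fmono n : F (t n) `<=` F (t n.+1).
  by apply: (uf_monotone hF) => //; exact: ltW.
case: (hDLR) => U0 Y0L2 Y0m eYt eUt eQR eY.
have sY0 := square_integrable_sqint_mx sM Y0L2.
pose x0 := mean_square P (Y 0%N).
have x00 : 0 <= x0 by exact: mean_square_ge0.
have KE : K = K1 Clgb T x0.
  rewrite hK; congr (K1 _ _ _); rewrite unlock.
  rewrite -[LHS]/(mean_square P (fun w => (U 0%N)^T *m Y 0%N w)).
  by apply: eq_mean_square => w; exact: fnorm_isometry.
have K0 : 0 < K by rewrite KE /K1 mulr_gt0 ?expR_gt0// mulr_gt0//; lra.
have sig n : (n <= N)%N -> 0 < sigma n /\ h ^+ 2 * (Clgb * K) <= sigma n.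
  by move=> nN; apply: step_restriction_sqr => //; exact: hdt.
have form n (v : 'cV[R]_k) : (n <= N)%N ->
    sigma n * fnorm v ^+ 2 <= (v^T *m second_moment P (Y n) *m v) 0 0.
  move=> nN; apply: rayleigh_smallest_eigenvalue; last exact: hsigma.
  exact: second_moment_sym.
(* Testing the form at one basis vector, available since [1 <= k], restates the step restriction at
   time 0 through [x0], as the growth bound expects it. *)
have s0x0 : sigma 0%N <= x0.
  pose e : 'cV[R]_k := delta_mx (Ordinal hk) 0.
  have e1 : fnorm e ^+ 2 = 1.
    rewrite fnorm_cvE (bigD1 (Ordinal hk))//= mxE !eqxx expr1n big1 ?addr0// => i i0.
    by rewrite mxE (negbTE i0) expr0n.
  have := form 0%N e (leq0n _); rewrite e1 mulr1 => /le_trans; apply.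
  rewrite second_moment_form// -[leRHS]mul1r; apply: le_mean_square => //.
    exact: sqint_mxMl.
  by move=> w; apply: (le_trans (fnorm_mul_le _ _)); rewrite fnorm_tr e1.
pose rho := 1 + 2 * (h * Num.sqrt Clgb) + 3 * (h ^+ 2 * Clgb) + 2 * (h * Clgb).
have rho_bound n : (n <= N)%N -> (1 + x0) * rho ^+ n <= K.
  move=> nN; apply: (growth_factor_bound hT hClgb x00 hN nN KE).
  exact: le_trans (sig 0%N (leq0n _)).2 s0x0.
have rho0 : 0 <= rho.
  have := sqrtr_ge0 Clgb; have := sqr_ge0 h => hh gg.
  by rewrite /rho !addr_ge0 ?mulr_ge0// ltW.
pose M := Num.min (sigma 0%N) (sigmaB ^+ 2 / (4 * Clgb * (1 + K))).
(* The moment bound controls [1 + E |Y_n| ^+ 2] by [K] itself, so the step yields a denominator with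
   [K], smaller than the stated one with [1 + K]. *)
have M_le : M <= sigmaB ^+ 2 / (4 * (Clgb * K)).
  rewrite ge_min; apply/orP; right; rewrite ler_wpM2l ?sqr_ge0//.
  have CK := mulr_gt0 hClgb K0.
  have le4 : 4 * (Clgb * K) <= 4 * Clgb * (1 + K) by lra.
  by rewrite lef_pV2// posrE; lra.
(* Adaptedness and square-integrability make the next increment white noise for the coefficients,
   and the fourth item keeps [K] valid as a moment bound. *)
suff inv n : (n <= N)%N ->
    [/\ sqint_mx P (Y n),
        forall i j, measurable_rv (F (t n)) (fun w => Y n w i j),
        U n *m (U n)^T = 1%:M,
        1 + mean_square P (Y n) <= (1 + x0) * rho ^+ n &
        forall v : 'cV[R]_k, M * fnorm v ^+ 2 <=
          (v^T *m second_moment P (Y n) *m v) 0 0].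
  move=> n nN; have [_ _ _ _ lb] := inv n.+1 nN.
  split=> [|v]; first by rewrite linearB/= second_moment_sym tr_scalar_mx.
  by rewrite quadratic_form_sub subr_ge0.
elim: n => [_|n ih nN].
  split => //.
  - rewrite /t mul0r; have s0 : sigma_algebra setT (F 0).
      exact: uf_sigma_algebra hF _ (lexx 0).
    exact: ((measurable_wrtP _ s0).1 Y0m).
  - by rewrite expr0 mulr1.
  - move=> v; apply: le_trans (form 0%N v (leq0n _)).
    by rewrite ler_wpM2r ?sqr_ge0// ge_min lexx.
have [sY gY UU xY lbY] := ih (ltnW nN).
have YK := le_trans xY (rho_bound n (ltnW nN)).
have [sn0 hsn] := sig n (ltnW nN).
pose X w := (U n)^T *m Y n w.
pose A w := a (t n) (X w); pose B w := b (t n) (X w).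
pose xi (j : 'I_m) w := W (t n.+1) w j 0 - W (t n) w j 0.
have noise : white_noise P (measurable_rv (F (t n))) h xi.
  by rewrite -(tS n); exact: (brownian_noise hF hW (t_ge0 n) (tlt n)).
have XY w : fnorm (X w) ^+ 2 = fnorm (Y n w) ^+ 2 by exact: fnorm_isometry.
have gX : forall i j, measurable_rv (F (t n)) (fun w => X w i j).
  by apply: measurable_rv_mulmx => // i j; exact: measurable_rv_cst.
have gA : forall i j, measurable_rv (F (t n)) (fun w => A w i j).
  exact: measurable_rv_coefficient.
have gB : forall i j, measurable_rv (F (t n)) (fun w => B w i j).
  exact: measurable_rv_coefficient.
have growth w : fnorm (A w) ^+ 2 + fnorm (B w) ^+ 2 <=
    Clgb * (1 + fnorm (Y n w) ^+ 2) by rewrite -XY; exact: hlgb.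
have mF f : measurable_rv (F (t n)) f -> measurable_fun setT f.
  by apply: measurable_rv_measurable => //; exact: uf_sub hF _ (t_ge0 n).
have sA : sqint_mx P A.
  apply: (sqint_mx_linear_growth (C := Clgb)) sY _ => [i j|w]; first exact: mF.
  by apply: le_trans (growth w); rewrite lerDl sqr_ge0.
have sB : sqint_mx P B.
  apply: (sqint_mx_linear_growth (C := Clgb)) sY _ => [i j|w]; first exact: mF.
  by apply: le_trans (growth w); rewrite lerDr sqr_ge0.
have YtE : Yt n.+1 = fun w => Y n w + h *: (U n *m A w) +
    U n *m B w *m \col_j xi j w.
  apply/funext => w; rewrite eYt//= -/(t n) -/(t n.+1) tS; congr (_ + _ *m _).
  by apply/matrixP => i j; rewrite ord1 !mxE.
have GM (f g : Omega -> R) : measurable_rv (F (t n)) f ->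
  measurable_rv (F (t n)) g -> measurable_rv (F (t n)) (fun w => f w * g w).
  exact: measurable_rvM.
have GD (f g : Omega -> R) : measurable_rv (F (t n)) f ->
  measurable_rv (F (t n)) g -> measurable_rv (F (t n)) (fun w => f w + g w).
  exact: measurable_rvD.
have Gc (c : R) : measurable_rv (F (t n)) (fun=> c) by exact: measurable_rv_cst.
have sYt : sqint_mx P (Yt n.+1).
  by rewrite YtE; exact: (sqint_mx_step GM GD Gc noise (U n) sY sA sB gY gA gB).
pose V := Ut n.+1 - U n.
have UtE : Ut n.+1 = U n + V by rewrite addrC subrK.
have V_eq : second_moment P (Y n) *m V =
    h *: (Emx P (fun w => Y n w *m (A w)^T) *m (1%:M - (U n)^T *m U n)).
  have [eU _] := eUt n nN.
  by rewrite mulmxBr eU -/(t n) -/(t n.+1) tS addrC addKr.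
have VU : V *m (U n)^T = 0.
  exact: (basis_increment_orthogonal UU sn0 (form n ^~ (ltnW nN)) V_eq).
have [QR UU' _ _] := eQR n nN.
have RR : (Rq n.+1)^T *m Rq n.+1 = 1%:M + V *m V^T.
  have UV : U n *m V^T = 0 by rewrite -[U n]trmxK -trmx_mul VU trmx0.
  transitivity (Ut n.+1 *m (Ut n.+1)^T).
    rewrite -{1}[Ut n.+1]trmxK QR trmx_mul trmxK mulmxA -(mulmxA _ (U n.+1)) UU'.
    by rewrite mulmx1.
  rewrite UtE linearD/= mulmxDl !mulmxDr UU UV VU.
  by rewrite addr0 add0r.
have sY' : sqint_mx P (Y n.+1).
  by rewrite (_ : Y n.+1 = fun w => Rq n.+1 *m Yt n.+1 w);
    [exact: sqint_mxMl|apply/funext => w; exact: eY].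
split => //.
- rewrite (_ : Y n.+1 = fun w => Rq n.+1 *m Yt n.+1 w); last first.
    by apply/funext => w; exact: eY.
  apply: measurable_rv_mulmx => [i j|]; first exact: measurable_rv_cst.
  rewrite YtE => i j; under [X in measurable_rv _ X]eq_fun do rewrite mxE.
  apply: measurable_rvD.
    apply: measurable_rv_mono (sgF n) (sgF n.+1) (Fmono n) _.
    under [X in measurable_rv _ X]eq_fun do rewrite mxE.
    apply: measurable_rvD => //; under [X in measurable_rv _ X]eq_fun do rewrite mxE.
    apply: measurable_rvM; first exact: measurable_rv_cst.
    by apply: measurable_rv_mulmx => // ? ?; exact: measurable_rv_cst.
  apply: measurable_rv_mulmx => {i j} [i j|i j].
    apply: measurable_rv_mono (sgF n) (sgF n.+1) (Fmono n) _.
    by apply: measurable_rv_mulmx => // ? ?; exact: measurable_rv_cst.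
  under [X in measurable_rv _ X]eq_fun do rewrite mxE.
  exact: (measurable_rv_increment hF hW (t_ge0 n) (tlt n)).
(* The triangular factor drops out of [X_{n+1}]: [U_{n+1}^T *m Y_{n+1} = Ut_{n+1}^T *m Yt_{n+1}],
   and [U_{n+1}^T] preserves norms. *)
- have -> : mean_square P (Y n.+1) = mean_square P (fun w => (U n + V)^T *m Yt n.+1 w).
    apply: eq_mean_square => w; rewrite -UtE QR -mulmxA -(eY n nN).
    by rewrite fnorm_isometry.
  rewrite YtE.
  apply: (le_trans (step_upper_bound GM GD Gc h0 hClgb noise UU sY sA sB gY gA gB
    growth sn0 (form n ^~ (ltnW nN)) V_eq YK hsn)).
  by rewrite [rho ^+ n.+1]exprSr [leRHS]mulrA ler_wpM2r.
- move=> v; rewrite second_moment_form//.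
  have -> : mean_square P (fun w => v^T *m Y n.+1 w) =
      mean_square P (fun w => ((Rq n.+1)^T *m v)^T *m Yt n.+1 w).
    by apply: eq_mean_square => w; rewrite eY// trmx_mul trmxK mulmxA.
  (* With a nonnegative [M], the bound at [Rq^T *m v] dominates the one at [v]. *)
  have M0 : 0 <= M.
    rewrite le_min (ltW hsigma0) divr_ge0 ?sqr_ge0// mulr_ge0//; lra.
  apply: (@le_trans _ _ (M * fnorm ((Rq n.+1)^T *m v) ^+ 2)).
    by rewrite ler_wpM2l//; exact: (expansive_trmx v RR).
  rewrite YtE.
  apply: (step_lower_bound GM GD Gc h0 hClgb noise UU sY sA sB gY gA gB growth
    YK (ltW hsigmaB) _ _ hsn _ M_le).
  + by move=> w; exact: hbb.
  + by rewrite -second_moment_form//; exact: form (ltnW nN).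
  + by rewrite -second_moment_form.
Qed.
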